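(* Let $q\ge 1$ and $m\ge 2q$ be integers. Let $\mathcal G$ be a connected color marked graph with exactly one edge, i.e. the complete color marked graph on a set of two vertices of $\mathbb Z^m\rtimes\mathbb Z/(2)$ which are joined by an edge (black or red) marked by some $\ell\in X_q$. Then its characteristic polynomial $\chi_{\mathcal G}(t)\in\mathbb Z[\xi_1,\dots,\xi_m][t]$ is irreducible over $\mathbb Z$ (i.e. it is irreducible as an element of $\mathbb Z[\xi_1,\dots,\xi_m,t]$).
   Context: Notation: $\mathbb N=\{0,1,2,\dots\}$; $e_1,\dots,e_m$ is the standard basis of $\mathbb Z^m$; for $\alpha\in\mathbb N^m$, $|\alpha|_1=\sum_i\alpha_i$, $\xi^\alpha=\prod_i\xi_i^{\alpha_i}$, and for $|\alpha|_1=r$, $\binom{r}{\alpha}=\frac{r!}{\alpha_1!\cdots\alpha_m!}$. Here $\xi_1,\dots,\xi_m$ are indeterminates, and half-integer powers $\xi^{\beta/2}$ denote monomials in $\sqrt{\xi_1},\dots,\sqrt{\xi_m}$. Edges. For $\ell=\sum_i\ell_ie_i\in\mathbb Z^m$ set $\eta(\ell)=\sum_i\ell_i$. Let $X_q$ be the set of $\ell\in\mathbb Z^m$ of the form $\ell=\sum_{j=1}^{2q}\pm e_{i_j}$ with $\ell\neq 0$, $\ell\neq -2e_i$ for all $i$, and $\eta(\ell)\in\{0,-2\}$. Elements with $\eta(\ell)=0$ are called black edges (the set $X_q^0$), and those with $\eta(\ell)=-2$ are called red edges (the set $X_q^{-2}$). Graph. The group $\mathbb Z^m\rtimes\mathbb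 Z/(2)$ consists of pairs $(a,\sigma)$, $a\in\mathbb Z^m$, $\sigma=\pm1$, with product $(a,\sigma)(b,\rho)=(a+\sigma b,\sigma\rho)$. A black edge $\ell$ is identified with $(\ell,+1)$ and a red edge $\ell$ with $(\ell,-1)$. The graph $\Lambda$ is the Cayley graph for left multiplication: two group elements $u,v$ are joined by an edge marked $\ell$ if $v=xu$, where $x$ is the group element identified with $\ell\in X_q$. Explicitly, $(a,\sigma)$ is joined to $(a+\ell,\sigma)$ for $\ell$ black and to $(\ell-a,-\sigma)$ for $\ell$ red. (Reversing the orientation replaces a black mark $\ell$ by $-\ell$ and leaves a red mark unchanged.) A complete color marked graph on a finite set of vertices $A\subset\mathbb Z^m\rtimes\mathbb Z/(2)$ is the full subgraph of $\Lambda$ generated by $A$. Matrix. Define $$A_r(\xi)=\sum_{k\in\mathbb N^m,\ |k|_1=r}\binom{r}{k}^2\xi^k,$$ and, for $a=\sum_in_ie_i\in\mathbb Z^m$, $$a(\xi)=\frac1{q+1}\sum_{i=1}^mn_i\frac{\partial}{\partial\xi_i}A_{q+1}(\xi).$$ For $\ell\in X_q$ write $\ell=\ell^+-\ell^-$ with $\ell^\pm\in\mathbb N^m$ of disjoint supports, and set $$c(\ell)=(q+1)\,\xi^{\frac{\ell^++\ell^-}2}\sum_{\alpha\in\mathbb N^m,\ |\alpha+\ell^+|_1=q}\binom{q}{\ell^++\alpha}\binom{q}{\ell^-+\alpha}\xi^\alpha\quad\text{if }\ell\in X_q^0,$$ $$c(\ell)=q\,\xi^{\frac{\ell^++\ell^-}2}\sum_{\alpha\in\mathbb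 N^m,\ |\alpha+\ell^+|_1=q-1}\binom{q+1}{\ell^-+\alpha}\binom{q-1}{\ell^++\alpha}\xi^\alpha\quad\text{if }\ell\in X_q^{-2}.$$ To a color marked graph $\mathcal G$ with finitely many vertices associate the matrix $C_{\mathcal G}$ indexed by its vertices as follows. The diagonal entry at $(a,\sigma)$ is $a(\xi)$ if $\sigma=1$ and $-a(\xi)+2(q+1)A_q(\xi)$ if $\sigma=-1$. The off-diagonal entry at position $((a,\sigma_a),(b,\sigma_b))$ is $\sigma_b\,c(\ell)$ if the two vertices are joined in $\mathcal G$ by an edge marked $\ell$, and $0$ otherwise. The characteristic polynomial of $\mathcal G$ is $\chi_{\mathcal G}(t)=\det(tI-C_{\mathcal G})$. *)

(* Defs.v *)
From HB Require Import structures.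
From mathcomp Require Import all_boot all_order all_algebra.
From mathcomp Require Import mpoly.

Set Implicit Arguments.
Unset Strict Implicit.
Unset Printing Implicit Defensive.

Import GRing.Theory.
Local Open Scope ring_scope.

(* The group Z^m >< Z/(2). The sign of (a, s) is (-1) ^+ s. *)
Definition zsd (m : nat) : Type := ('rV[int]_m * bool)%type.

HB.instance Definition _ m := Choice.copy (zsd m) ('rV[int]_m * bool)%type.

Definition zsd_one m : zsd m := (0, false).
Definition zsd_mul m (x y : zsd m) : zsd m :=
  (x.1 + (-1) ^+ x.2 *: y.1, x.2 (+) y.2).
Definition zsd_inv m (x : zsd m) : zsd m := (- ((-1) ^+ x.2 *: x.1), x.2).

Fact zsd_mulA m : associative (@zsd_mul m).
Proof.
move=> [a s] [b t] [c r]; rewrite /zsd_mul /= addbA.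
by rewrite scalerDr scalerA signr_addb addrA.
Qed.

Fact zsd_mul1 m : left_id (@zsd_one m) (@zsd_mul m).
Proof. by move=> [a s]; rewrite /zsd_mul /= expr0 scale1r add0r. Qed.

Fact zsd_mulr1 m : right_id (@zsd_one m) (@zsd_mul m).
Proof. by move=> [a s]; rewrite /zsd_mul /= scaler0 addr0 addbF. Qed.

Fact zsd_mulV m : left_inverse (@zsd_one m) (@zsd_inv m) (@zsd_mul m).
Proof. by move=> [a s]; rewrite /zsd_mul /= addNr addbb. Qed.

Fact zsd_mulrV m : right_inverse (@zsd_one m) (@zsd_inv m) (@zsd_mul m).
Proof.
move=> [a s]; rewrite /zsd_mul /= scalerN scalerA -expr2 sqrr_sign.
by rewrite scale1r subrr addbb.
Qed.

HB.instance Definition _ m := isGroup.Build (zsd m)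
  (@zsd_mulA m) (@zsd_mul1 m) (@zsd_mulr1 m) (@zsd_mulV m) (@zsd_mulrV m).

Definition basis_vec m (i : 'I_m) : 'rV[int]_m := delta_mx 0 i.

Definition eta m (l : 'rV[int]_m) : int := \sum_(i < m) l 0 i.

Definition edges (q : nat) {m : nat} : {pred 'rV[int]_m} := [pred l |
  [&& [exists f : {ffun 'I_(2 * q) -> 'I_m * bool},
         l == \sum_j (-1) ^+ (f j).2 *: basis_vec (f j).1],
      l != 0,
      [forall i, l != - (basis_vec i *+ 2)]
    & (eta l == 0) || (eta l == - 2)]].

Definition black_edges (q : nat) {m : nat} : {pred 'rV[int]_m} :=
  [pred l | (l \in edges q) && (eta l == 0)].
Definition red_edges (q : nat) {m : nat} : {pred 'rV[int]_m} :=
  [pred l | (l \in edges q) && (eta l == - 2)].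

(* A black edge l is (l, +1), a red one is (l, -1). *)
Definition edge_elt m (l : 'rV[int]_m) : zsd m := (l, eta l == - 2).

(* In the Cayley graph Lambda, u is joined to v by an edge marked l. *)
Definition joined q m (l : 'rV[int]_m) (u v : zsd m) : bool :=
  (l \in edges q) && (v == edge_elt l * u)%g.

(* The only possible mark of an edge from u to v. *)
Definition mark m (u v : zsd m) : 'rV[int]_m := (v / u)%g.1.

Definition multinomial m (a : 'X_{1..m}) : nat :=
  (mdeg a)`! %/ \prod_(i < m) (a i)`!.

(* The bound in 'X_{1..m < r.+1} only makes the index set finite; all
   multi-indices of degree r satisfy it. *)
Definition polyA m r : {mpoly rat[m]} :=
  \sum_(k : 'X_{1..m < r.+1} | mdeg k == r)
     ((multinomial k) ^ 2)%:R *: 'X_[k].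

Definition lin_poly q m (a : 'rV[int]_m) : {mpoly rat[m]} :=
  (q.+1)%:R^-1 *: \sum_(i < m) (a 0 i)%:~R *: (polyA m q.+1)^`M(i).

Definition pos_part m (l : 'rV[int]_m) : 'X_{1..m} :=
  [multinom (if (0 <= l 0 i)%R then absz (l 0 i)%R else 0%N) | i < m].
Definition neg_part m (l : 'rV[int]_m) : 'X_{1..m} := pos_part (- l).

(* The matrix has its entries in Q[sqrt xi_1, ..., sqrt xi_m]: the variables of
   the polynomials below are the square roots of the xi_i, and [in_sqrt]
   substitutes xi_i := 'X_i ^+ 2. In particular xi^(b/2) is 'X_[b]. *)
Definition in_sqrt m (p : {mpoly rat[m]}) : {mpoly rat[m]} :=
  p \mPo [tuple 'X_i ^+ 2 | i < m].

Definition black_coef q m (l : 'rV[int]_m) : {mpoly rat[m]} :=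
  let lp := pos_part l in let lm := neg_part l in
  (q.+1)%:R *: ('X_[(lp + lm)%MM] * in_sqrt
    (\sum_(a : 'X_{1..m < q.+1} | mdeg (a + lp)%MM == q)
       (multinomial (lp + a)%MM * multinomial (lm + a)%MM)%:R *: 'X_[a])).

Definition red_coef q m (l : 'rV[int]_m) : {mpoly rat[m]} :=
  let lp := pos_part l in let lm := neg_part l in
  q%:R *: ('X_[(lp + lm)%MM] * in_sqrt
    (\sum_(a : 'X_{1..m < q.+1} | mdeg (a + lp)%MM == q.-1)
       (multinomial (lm + a)%MM * multinomial (lp + a)%MM)%:R *: 'X_[a])).

Definition edge_coef q m (l : 'rV[int]_m) : {mpoly rat[m]} :=
  if l \in black_edges q then black_coef q l
  else if l \in red_edges q then red_coef q l else 0.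

(* The matrix of the complete color marked graph with vertices V. *)
Definition graph_mx q m n (V : n.-tuple (zsd m)) : 'M[{mpoly rat[m]}]_n :=
  \matrix_(i, j)
    let u := tnth V i in let v := tnth V j in
    if i == j then
      in_sqrt (if u.2 then - lin_poly q u.1 + (2 * q.+1)%:R *: polyA m q
               else lin_poly q u.1)
    else if joined q (mark u v) u v then
      (-1) ^+ v.2 * edge_coef q (mark u v)
    else 0.

(* The embedding of Z[xi_1, ..., xi_m][t] into Q[sqrt xi_1, ..., sqrt xi_m][t]. *)
Definition embed m (p : {poly {mpoly int[m]}}) : {poly {mpoly rat[m]}} :=
  map_poly (fun c : {mpoly int[m]} => in_sqrt (map_mpoly intr c)) p.

Lemma mcoeff_in_sqrt m (p : {mpoly rat[m]}) (k : 'X_{1..m}) :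
  (in_sqrt p)@_(k *+ 2)%MM = p@_k.
Proof.
rewrite /in_sqrt comp_mpolyE raddf_sum /= [in RHS](mpolyE p) raddf_sum /=.
apply: eq_bigr => a _; rewrite !mcoeffZ; congr (_ * _).
have -> : \prod_(i < m) tnth [tuple 'X_i ^+ 2 | i < m] i ^+ a i
          = 'X_[rat, (a *+ 2)%MM].
  rewrite [RHS]mpolyXE_id; apply: eq_bigr => i _.
  by rewrite tnth_mktuple mulmnE -exprM mulnC.
rewrite !mcoeffX; congr (nat_of_bool _)%:R.
apply/eqP/eqP => [/mnmP e|-> //]; apply/mnmP => i.
by have := e i; rewrite !mulmnE => /eqP; rewrite eqn_pmul2r // => /eqP.
Qed.

Lemma embed_inj m : injective (@embed m).
Proof.
apply: map_inj_poly => [c d e|]; last by rewrite /in_sqrt !raddf0.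
have {}e k : (map_mpoly intr c)@_k = (map_mpoly intr d)@_k :> rat.
  by rewrite -mcoeff_in_sqrt e mcoeff_in_sqrt.
apply/mpolyP => k; move: (e k); rewrite !mcoeff_map_mpoly.
exact: intr_inj.
Qed.

(* Polydiv's [irreducible_poly] is irreducibility up to constant factors, which
   is not the right notion over a ring that is not a field. *)
Definition irreducible_elt (R : idomainType) (p : R) : Prop :=
  [/\ p != 0, p \isn't a GRing.unit
    & forall a b : R, p = a * b ->
        a \is a GRing.unit \/ b \is a GRing.unit].

(* Main.v *)
Require Import Defs.
From mathcomp Require Import all_boot all_order all_algebra all_field.
From mathcomp Require Import mpoly.
From mathcomp Require Import ring zify.

(** A graph with one edge has a 2 x 2 matrix, and its characteristic polynomial is a monic
quadratic t^2 - T t + D over Z[xi]. Over any domain such a quadratic factors only if the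
discriminant T^2 - 4 D is a square ([monic_quadratic_irreducible]). If the edge is marked by
l = sum_i l_i e_i, the discriminant is

    B^2 + 4 c(l)^2  with  B = l(xi)                     for a black edge,
    B^2 - 4 c(l)^2  with  B = l(xi) - 2 (q+1) A_q(xi)   for a red edge,

and c(l)^2 = K^2 xi^(l+ + l-) S^2 with K constant and S = [edge_sum]. Suppose that it equals E^2.
Then (E - B) (E + B) is a constant times xi^(l+ + l-) S^2, a product of a large monomial and a
square. The two factors differ by 2 B, so a variable that does not divide B can divide only one of
them. Each case below turns this into a contradiction after a specialisation of the variables.

If the degree of l+ is as large as possible, then S is a constant ([edge_sum_top]) and the product
is a constant times a monomial. Since sum_i |l_i| <= 2 q <= m, some coordinate l_h is at most 1 in
absolute value, and for q >= 2 the monomial has degree less than q in xi_h while B has degree q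
in xi_h: this is impossible ([sq_sub_sq_neq_monomial]). For q = 1 the monomial is xi_i xi_j, and
the coefficients of B have the wrong product ([sq_sub_sq_eq_XiXj]).

In the other cases, and for a black edge as soon as some l_h = 0, set xi_i = eps for i in the
support of l. The behaviour at eps = 0 comes from the identity
(xi_i d_i^2 + d_i) A_{r+1} = (r+1)^2 A_r ([polyA_laplace]), which gives the first and second
derivatives of A_{q+1} at points where the coordinates in the support of l vanish.

For a red edge there are now two indices h1, h2 outside the support. At eps = 0, B becomes a
nonzero multiple of A_q and S one of A_r with r < q, in the remaining variables. The whole power
of eps goes into one factor and the other one becomes 2 B up to sign, so A_q divides A_r^2 up to a
constant ([sq_sub_sq_Xn]). In two variables A_q(s, 1) = sum_j C(q, j)^2 s^j is squarefree, since it
satisfies a form of the Legendre differential equation, so this contradicts q > r ([sqbin_dvd]).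

For a black edge, B vanishes to first order in eps, with linear term a multiple of
sum_i l_i xi_i. Moving one variable of the support to w eps makes this term a multiple of w - 1,
whereas c(l)^2 only contributes powers of w; again one has to divide the other. The only exception
is l = e_i - e_j, where both terms of the discriminant have the same order in eps, and there the
constants do not match ([black_disc_nonsquare_zero_coord]). *)

Set Implicit Arguments.
Unset Strict Implicit.
Unset Printing Implicit Defensive.
Import Order.TTheory GRing.Theory Num.Theory.
Local Open Scope ring_scope.

(** * Differences of two squares in a polynomial ring *)

Lemma poly_root0 (R : idomainType) (p : {poly R}) :
  p.[0] = 0 -> exists p1, p = 'X * p1.
Proof.
move=> p0; have /factor_theorem[p1 ->] : root p 0 by rewrite /root p0.
by exists p1; rewrite subr0 mulrC.
Qed.

Lemma polyX_mulI (R : idomainType) (p r : {poly R}) : 'X * p = 'X * r -> p = r.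
Proof. by apply: mulfI; rewrite polyX_eq0. Qed.

(** A factor with nonzero constant term is prime to ['X], so the other factor
    absorbs the whole power of ['X]. *)
Lemma mul_Xn_factor (R : idomainType) N (G H W : {poly R}) :
  G * H = 'X^N * W -> H.[0] != 0 ->
  exists g, G = 'X^N * g /\ g.[0] * H.[0] = W.[0].
Proof.
move=> + H0; elim: N G => [|N IH] G GH.
  by exists G; rewrite expr0 mul1r -hornerM GH expr0 mul1r.
have /eqP : (G * H).[0] = 0 by rewrite GH exprS !hornerM hornerX !mul0r.
rewrite hornerM mulf_eq0 (negPf H0) orbF => /eqP /poly_root0[G1 eG].
have /IH[g [eG1 gW]] : G1 * H = 'X^N * W.
  by apply: polyX_mulI; rewrite mulrA -eG GH exprS mulrA.
by exists g; rewrite eG eG1 exprS mulrA.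
Qed.

(** At 0 one of [E - B] and [E + B] vanishes; the other one is then [2 B] up to
    sign, so it does not vanish and [mul_Xn_factor] applies. *)
Lemma sq_sub_sq_Xn (R : idomainType) N (E B W : {poly R}) :
  2%:R != 0 :> R -> E ^+ 2 - B ^+ 2 = 'X^(N.+1) * W -> B.[0] != 0 ->
  exists g, W.[0] = g * B.[0].
Proof.
move=> two0 EBW B0; have EBW' : (E - B) * (E + B) = 'X^(N.+1) * W.
  by rewrite -EBW; ring.
have : (E - B).[0] * (E + B).[0] = 0.
  by rewrite -hornerM EBW' exprS !hornerM hornerX !mul0r.
rewrite !hornerE => /eqP; rewrite mulf_eq0 subr_eq0 addr_eq0 => /orP[] /eqP eE.
  have [|g [_ <-]] := mul_Xn_factor EBW'.
    by rewrite hornerD eE -mulr2n -mulr_natl mulf_neq0.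
  by exists (g.[0] * 2%:R); rewrite hornerD eE -mulrA mulr_natl mulr2n.
have [||g [_ <-]] := @mul_Xn_factor _ N.+1 (E + B) (E - B) W.
- by rewrite mulrC.
- by rewrite !hornerE eE -opprD oppr_eq0 -mulr2n -mulr_natl mulf_neq0.
by exists (- (g.[0] * 2%:R)); rewrite !hornerE eE; ring.
Qed.

(** Both factors [E - B] and [E + B] are nonzero, so neither is larger than their
    product, and then so is their difference [2 B]. *)
Lemma sq_sub_sq_small (R : idomainType) q (E B W : {poly R}) :
  2%:R != 0 :> R -> E ^+ 2 - B ^+ 2 = W -> W != 0 -> (size W <= q)%N ->
  B`_q = 0.
Proof.
move=> two0 EBW W0 Wq; have {}EBW : (E - B) * (E + B) = W by rewrite -EBW; ring.
have : (E - B) * (E + B) != 0 by rewrite EBW.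
rewrite mulf_eq0 negb_or => /andP[n1 n2].
have sW := size_mul n1 n2.
rewrite EBW in sW; move: n1 n2; rewrite -!size_poly_gt0 => n1 n2.
have b1 : (size (E - B)%R <= q)%N by lia.
have b2 : (size (E + B)%R <= q)%N by lia.
have : (2%:R * B)`_q = 0.
  have -> : 2%:R * B = (E + B) - (E - B) by ring.
  by rewrite coefB !nth_default // subrr.
by rewrite mulr_natl coefMn -mulr_natl => /eqP; rewrite mulf_eq0 (negPf two0) => /eqP.
Qed.

(** One of [E - B] and [E + B] is a constant [g]; as the other one differs from it
    by [2 B] up to sign and has no constant term, [g] is determined by [B]. *)
Lemma sq_sub_sq_X (R : idomainType) (c : R) (E B : {poly R}) :
  2%:R != 0 :> R -> E ^+ 2 - B ^+ 2 = c *: 'X -> c != 0 ->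
  c = - 4%:R * (B`_0 * B`_1).
Proof.
move=> two0 EBW c0; have {}EBW : (E - B) * (E + B) = c *: 'X by rewrite -EBW; ring.
have key (G H : {poly R}) : G * H = c *: 'X -> (size G <= 1)%N ->
    c = - (H`_0 - G`_0) * (H`_1 - G`_1).
  move=> + /size1_polyC eG; rewrite {}eG coefC /= [(_%:P)`_1]coefC /= subr0.
  set g := G`_0; rewrite mul_polyC => gH.
  have g0 : g != 0.
    apply: contraNneq c0 => g0; move: gH; rewrite g0 scale0r => /esym/eqP.
    by rewrite -mul_polyC mulf_eq0 polyC_eq0 polyX_eq0 orbF.
  have h0 : H`_0 = 0.
    have /eqP : g * H`_0 = 0 by rewrite -coefZ gH coefZ coefX mulr0.
    by rewrite mulf_eq0 (negPf g0) => /eqP.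
  have h1 : g * H`_1 = c by rewrite -coefZ gH coefZ coefX mulr1.
  by rewrite h0 -h1; ring.
have : (E - B) * (E + B) != 0 by rewrite EBW -mul_polyC mulf_eq0 polyC_eq0 polyX_eq0 orbF.
rewrite mulf_eq0 negb_or => /andP[n1 n2].
have sW := size_mul n1 n2.
rewrite EBW size_scale // size_polyX in sW.
have : (size (E - B)%R <= 1)%N || (size (E + B)%R <= 1)%N.
  by move: n1 n2; rewrite -!size_poly_gt0; lia.
case/orP => s1.
  by rewrite (key _ _ EBW s1) !coefB !coefD; ring.
by rewrite mulrC in EBW; rewrite (key _ _ EBW s1) !coefB !coefD; ring.
Qed.

Lemma sq_sub_mulX (R : idomainType) (E b : {poly R}) N (W : {poly R}) :
  E ^+ 2 - ('X * b) ^+ 2 = 'X^(N.+2) * W ->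
  exists E1, E1 ^+ 2 - b ^+ 2 = 'X^N * W.
Proof.
move=> eE; have : (E ^+ 2).[0] = 0.
  by rewrite -(subrK (('X * b) ^+ 2) (E ^+ 2)) eE !hornerE !exprS !hornerE; ring.
rewrite horner_exp => /eqP; rewrite expf_eq0 /= => /eqP /poly_root0[E1 eE1].
exists E1; apply/polyX_mulI/polyX_mulI.
transitivity ('X^(N.+2) * W); last by rewrite !exprS; ring.
by rewrite -eE eE1; ring.
Qed.

Lemma two_neq0 (R : numDomainType) : 2%:R != 0 :> R.
Proof. by rewrite pnatr_eq0. Qed.

Lemma poly_two_neq0 (R : numDomainType) : 2%:R != 0 :> {poly R}.
Proof. by rewrite -polyC_natr polyC_eq0 two_neq0. Qed.

(** * Sums of squared binomials times powers of X *)

Section SquaredBinomials.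
Variable F : numClosedFieldType.

Definition sqbin_poly n : {poly F} := \poly_(j < n.+1) ('C(n, j) ^ 2)%:R.

Lemma coef_sqbin n j : (sqbin_poly n)`_j = ('C(n, j) ^ 2)%:R.
Proof. by rewrite coef_poly; case: ltnP => // /bin_small ->. Qed.

Lemma size_sqbin n : size (sqbin_poly n) = n.+1.
Proof. by rewrite size_poly_eq //= binn oner_neq0. Qed.

(** The polynomial of index [n] is (1 - X)^n P_n((1 + X)/(1 - X)) with P_n the
    Legendre polynomial; this is the transported Legendre equation, equivalent to the
    two-term recurrence of the coefficients. *)
Lemma sqbin_ode n :
  let f := sqbin_poly n in
  'X * (1 - 'X) * f^`()^`() = (n ^ 2)%:R *: f - ((2 * n)%:R *: 'X - 'X + 1) * f^`().
Proof.
move=> f.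
have E j : j.+1%:R ^+ 2 * f`_j.+1 - (n%:R - j%:R) ^+ 2 * f`_j = 0.
  apply/eqP; rewrite subr_eq0 !coef_sqbin !natrX -!exprMn -!natrM; apply/eqP.
  have [jn|nj] := leqP j n; first by rewrite -natrB // -natrM mul_bin_left.
  by rewrite !bin_small ?muln0 ?mulr0 // ltnW.
apply/polyP => j; rewrite -mulrA mulrBl mul1r mulrDl mulrBl mul1r -scalerAl.
rewrite !(coefD, coefN, coefZ, coefXM) natrX natrM; apply: subr0_eq.
case: j => [|[|j]]; rewrite /= !coef_deriv.
- by apply: etrans (E 0%N); ring.
- by apply: etrans (E 1%N); ring.
- by apply: etrans (E j.+2); ring.
Qed.

(** A solution of a second order equation cannot have a multiple root away from
    the zeros 0 and 1 of its leading coefficient, and neither of these is a root. *)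
Lemma sqbin_simple_root n x :
  root (sqbin_poly n) x -> (sqbin_poly n)^`().[x] != 0.
Proof.
set f := sqbin_poly n => fx; apply/eqP => f'x.
have f0 : f != 0 by rewrite -size_poly_gt0 size_sqbin.
have x0 : x != 0.
  apply: contraTneq fx => ->; rewrite /root horner_coef0 coef_sqbin bin0.
  exact: oner_neq0.
have x1 : 1 - x != 0.
  rewrite subr_eq0 eq_sym; apply: contraTneq fx => ->.
  rewrite /root horner_poly; apply: lt0r_neq0.
  rewrite big_ord_recl bin0 expr1n mulr1 ltr_pwDl ?ltr01 //.
  by apply: sumr_ge0 => i _; rewrite expr1n mulr1 ler0n.
have [[|[|k]] [g + fE]] := multiplicity_XsubC f x; rewrite f0 /= => gx.
- by move: fx; rewrite fE mulr1 (negPf gx).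
- move: f'x gx; rewrite fE expr1 derivM derivXsubC !hornerE /= /root.
  by rewrite subrr mulr0 add0r => ->; rewrite eqxx.
set D := 'X - x%:P in fE.
pose h := k.+2%:R *: g + D * g^`().
have f'E : f^`() = h * D ^+ k.+1.
  rewrite fE derivM deriv_exp derivXsubC /h -mul_polyC polyC_natr /= exprS.
  by rewrite -[_ *+ k.+2]mulr_natr; ring.
have f''E : f^`()^`() = (k.+1%:R *: h + D * h^`()) * D ^+ k.
  rewrite f'E derivM deriv_exp derivXsubC -mul_polyC polyC_natr /= exprS.
  by rewrite -[_ *+ k.+1]mulr_natr; ring.
have ode : 'X * (1 - 'X) * (k.+1%:R *: h + D * h^`())
    = D * ((n ^ 2)%:R *: (D * g) - ((2 * n)%:R *: 'X - 'X + 1) * h).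
  have Dk : D ^+ k != 0 by rewrite expf_neq0 ?polyXsubC_eq0.
  apply: (mulIf Dk); rewrite -[LHS]mulrA -f''E sqbin_ode -/f f'E {1}fE -!mul_polyC.
  by rewrite !exprS; ring.
have /eqP := congr1 (horner^~ x) ode.
rewrite /h /D !hornerE subrr !mul0r !addr0 mulrA !mulf_eq0 (negPf x0) (negPf x1).
by rewrite !pnatr_eq0 /=; apply/negP.
Qed.

(** The divisor is squarefree by [sqbin_simple_root], so it already divides
    [sqbin_poly r], and degrees can be compared. *)
Lemma sqbin_dvd n r c : c != 0 ->
  sqbin_poly n %| c *: sqbin_poly r ^+ 2 -> (n <= r)%N.
Proof.
move=> c0 dv; have [s fE] := closed_field_poly_normal (sqbin_poly n).
have f0 : sqbin_poly n != 0 by rewrite -size_poly_gt0 size_sqbin.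
have lf : lead_coef (sqbin_poly n) != 0 by rewrite lead_coef_eq0.
have us : uniq s.
  rewrite -separable_prod_XsubC separable_poly.unlock.
  have := fE; move/(congr1 (fun p => (lead_coef (sqbin_poly n))^-1 *: p)).
  rewrite scalerA mulVf // scale1r => <-.
  rewrite derivZ coprimepZl ?coprimepZr ?invr_eq0 //.
  by apply/Pdiv.ClosedField.coprimepP => x; apply: sqbin_simple_root.
have : sqbin_poly n %| sqbin_poly r.
  rewrite fE dvdpZl //; apply: uniq_roots_dvdp; last by rewrite uniq_rootsE.
  apply/allP => z zs; have : root (sqbin_poly n) z.
    by rewrite fE rootZ // root_prod_XsubC.
  by move/(root_dvdp dv); rewrite rootZ // root_exp //; apply: mulrC.
move/dvdp_leq; rewrite -size_poly_gt0 !size_sqbin ltnS; exact.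
Qed.

End SquaredBinomials.

(** * Multinomial coefficients and the coefficients of A_r and a(xi) *)

Lemma dvdn_prod_fact (I : Type) (r : seq I) (F : I -> nat) :
  (\prod_(i <- r) (F i)`! %| (\sum_(i <- r) F i)`!)%N.
Proof.
elim: r => [|i r IH]; first by rewrite !big_nil.
rewrite !big_cons; apply: dvdn_trans (dvdn_mul (dvdnn _) IH) _.
set s := (\sum_(j <- r) _)%N.
by rewrite -(@bin_fact (F i + s) (F i)) ?leq_addr // addKn dvdn_mull.
Qed.

Section Multinomial.
Variable m : nat.
Implicit Types a b k : 'X_{1..m}.

Lemma multinomial_fact k :
  (multinomial k * \prod_(i < m) (k i)`! = (mdeg k)`!)%N.
Proof. by rewrite /multinomial mdegE divnK ?dvdn_prod_fact. Qed.

Lemma prod_fact_gt0 k : (0 < \prod_(i < m) (k i)`!)%N.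
Proof. by apply: prodn_gt0 => i; apply: fact_gt0. Qed.

Lemma multinomial_gt0 k : (0 < multinomial k)%N.
Proof. by have := fact_gt0 (mdeg k); rewrite -multinomial_fact muln_gt0 => /andP[]. Qed.

Lemma multinomial_addU k i :
  (multinomial (k + U_(i))%MM * (k i).+1 = (mdeg k).+1 * multinomial k)%N.
Proof.
apply/eqP; rewrite -(eqn_pmul2r (prod_fact_gt0 k)) -[X in _ == X]mulnA.
rewrite multinomial_fact -factS; apply/eqP.
have -> : (mdeg k).+1 = mdeg (k + U_(i))%MM by rewrite mdegD mdeg1 addn1.
rewrite -multinomial_fact -mulnA; congr (_ * _)%N.
rewrite (bigD1 i) //= [in RHS](bigD1 i) //= mnmDE mnm1E eqxx addn1 factS mulnA.
congr (_ * _)%N; apply: eq_bigr => j ji.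
by rewrite mnmDE mnm1E eq_sym (negPf ji) addn0.
Qed.

Lemma multinomial_disjoint a b : (forall i, (a i == 0%N) || (b i == 0%N)) ->
  multinomial (a + b)%MM = (multinomial a * multinomial b * 'C(mdeg a + mdeg b, mdeg a))%N.
Proof.
move=> ab0; apply/eqP.
rewrite -(eqn_pmul2r (prod_fact_gt0 (a + b)%MM)) multinomial_fact mdegD.
have -> : (\prod_i ((a + b)%MM i)`! = \prod_i (a i)`! * \prod_i (b i)`!)%N.
  rewrite -big_split; apply: eq_bigr => i _ /=; rewrite mnmDE.
  by case/orP: (ab0 i) => /eqP ->; rewrite ?addn0 fact0 ?mul1n ?muln1.
apply/eqP; rewrite -(@bin_fact (mdeg a + mdeg b) (mdeg a)) ?leq_addr //.
by rewrite addKn -!multinomial_fact; ring.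
Qed.

Lemma multinomial_axis (i : 'I_m) n : multinomial (U_(i) *+ n)%MM = 1%N.
Proof.
rewrite /multinomial mdegMn mdeg1 mul1n (bigD1 i) //= big1 => [|j ji].
  by rewrite mulmnE mnm1E eqxx mul1n muln1 divnn fact_gt0.
by rewrite mulmnE mnm1E eq_sym (negPf ji).
Qed.

Lemma multinomialU (i : 'I_m) : multinomial U_(i)%MM = 1%N.
Proof. by rewrite -[U_(i)%MM]mulm1n multinomial_axis. Qed.

Lemma multinomial0 : multinomial (0%MM : 'X_{1..m}) = 1%N.
Proof. by rewrite /multinomial mdeg0 big1 // => i _; rewrite mnm0E. Qed.

End Multinomial.

Section Legendre.
Variable m : nat.
Implicit Types (k : 'X_{1..m}) (i j : 'I_m).

Lemma mcoeff_sum_bmnm n (P : pred 'X_{1..m}) (F : 'X_{1..m} -> rat) k :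
  (\sum_(a : 'X_{1..m < n} | P a) F a *: 'X_[a])@_k
    = if (mdeg k < n)%N && P k then F k else 0.
Proof.
rewrite raddf_sum /=; case: ifP => [/andP[kn Pk]|kn].
  rewrite (bigD1 (BMultinom kn)) //= big1 => [|a /andP[Pa ak]].
    by rewrite mcoeffZ mcoeffX eqxx mulr1 addr0.
  by move: ak; rewrite bmeqP /= mcoeffZ mcoeffX => /negPf ->; rewrite mulr0.
rewrite big1 // => a Pa; rewrite mcoeffZ mcoeffX; case: eqP => [ak|]; last by rewrite mulr0.
by rewrite -ak bmdeg Pa in kn.
Qed.

Lemma mcoeff_polyA r k :
  (polyA m r)@_k = if mdeg k == r then (multinomial k ^ 2)%:R else 0.
Proof.
rewrite (mcoeff_sum_bmnm r.+1 (fun k => mdeg k == r)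
  (fun k => (multinomial k ^ 2)%:R)) (_ : _ && _ = (mdeg k == r)) //.
by case: eqP => [->|]; rewrite ?ltnSn ?andbF.
Qed.

Lemma mderivXU i j : ('X_i : {mpoly rat[m]})^`M(j) = (i == j)%:R.
Proof.
rewrite mderivX mnm1E; case: eqP => [->|_]; last by rewrite scale0r.
have -> : (U_(j) - U_(j) = 0 :> 'X_{1..m})%MM.
  by apply/mnmP => h; rewrite mnmBE subnn mnm0E.
by rewrite mpolyX0 scale1r.
Qed.

(** The generating series of the A_r / r!^2 is a product of the functions
    I(xi_i t) with I(x) the sum of the x^j / j!^2, and I satisfies (x I')' = I. *)
Lemma polyA_laplace r i :
  'X_i * (polyA m r.+1)^`M(i)^`M(i) + (polyA m r.+1)^`M(i)
    = (r.+1 ^ 2)%:R *: polyA m r.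
Proof.
have <- : ('X_i * (polyA m r.+1)^`M(i))^`M(i) =
    'X_i * (polyA m r.+1)^`M(i)^`M(i) + (polyA m r.+1)^`M(i).
  by rewrite mderivM mderivXU eqxx mul1r addrC.
apply/mpolyP => k; rewrite mcoeffZ mcoeff_deriv mulrC addmC mcoeffMX mcoeff_deriv.
rewrite !mcoeff_polyA mdegD mdeg1 addn1 eqSS; case: eqP => [<-|_].
  rewrite -[RHS]natrM -!mulrnA; congr _%:R.
  by rewrite -expnMn -(multinomial_addU k i) expnMn; ring.
by rewrite !mul0rn mulr0.
Qed.

Lemma mcoeff_lin_poly q (a : 'rV[int]_m) k :
  (lin_poly q a)@_k = if mdeg k == q then
    \sum_j (a 0 j)%:~R * (multinomial (k + U_(j))%MM * multinomial k)%:R else 0.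
Proof.
rewrite mcoeffZ raddf_sum /= mulr_sumr; case: eqP => [kq|kq]; last first.
  rewrite big1 // => j _; rewrite mcoeffZ mcoeff_deriv mcoeff_polyA mdegD mdeg1 addn1 eqSS.
  by move/eqP/negPf: kq => ->; rewrite mul0rn !mulr0.
apply: eq_bigr => j _.
rewrite mcoeffZ mcoeff_deriv mcoeff_polyA mdegD mdeg1 addn1 kq eqxx mulrCA; congr (_ * _).
have q0 : q.+1%:R != 0 :> rat by rewrite pnatr_eq0.
apply: (mulfI q0); rewrite mulrA divff // mul1r -mulrnA -[RHS]natrM.
have := multinomial_addU k j; rewrite kq => e; congr _%:R.
by rewrite [RHS]mulnCA -e; ring.
Qed.

End Legendre.

(** * Values on the coordinate subspace where an edge vanishes *)

Section Evaluation.
Variables (m : nat) (R : comNzRingType) (phi : {rmorphism rat -> R}).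
Implicit Types (p : {mpoly rat[m]}) (x y : 'I_m -> R) (k : 'X_{1..m}).

Lemma mmap_XU x i : mmap phi x 'X_i = x i.
Proof. by rewrite mmapX mmap1U. Qed.

Lemma mmapM x : {morph mmap phi x : p1 p2 / p1 * p2}.
Proof. exact: rmorphM. Qed.

(** Monomials involving a variable that is sent to 0 do not contribute. *)
Lemma eq_mmap y p1 p2 :
  (forall k, (forall i, y i = 0 -> k i = 0%N) -> p1@_k = p2@_k) ->
  mmap phi y p1 = mmap phi y p2.
Proof.
move=> eqp; apply/eqP; rewrite -subr_eq0 -raddfB; apply/eqP.
apply: big1 => k _; case: (boolP [forall i, (y i == 0) ==> (k i == 0%N)]).
  move=> /forallP yk; rewrite mcoeffB eqp ?subrr ?raddf0 ?mul0r // => i /eqP yi.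
  by apply/eqP; have := yk i; rewrite yi.
rewrite negb_forall => /existsP[i]; rewrite negb_imply => /andP[/eqP yi ki].
by rewrite /mmap1 (bigD1 i) //= yi expr0n (negPf ki) mul0r mulr0.
Qed.

Lemma mmap_polyA_laplace y r i : y i = 0 ->
  mmap phi y (polyA m r.+1)^`M(i) = (r.+1 ^ 2)%:R * mmap phi y (polyA m r).
Proof.
move=> yi; have := congr1 (mmap phi y) (polyA_laplace r i).
by rewrite mmapD mmapM mmap_XU yi mul0r add0r mmapZ rmorph_nat.
Qed.

(** This is the derivative of [polyA_laplace] along xi_j, evaluated at y. If
    [i = j] the Laplace operator contributes the second derivative twice, which explains the
    factor 2. *)
Lemma mmap_polyA_laplace2 y r i j : y i = 0 -> y j = 0 ->
  2%:R * mmap phi y (polyA m r.+2)^`M(i)^`M(j)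
    = (r.+2 ^ 2 * r.+1 ^ 2)%:R * (2%:R - (i == j)%:R) * mmap phi y (polyA m r).
Proof.
move=> yi yj; have := congr1 (fun p => mmap phi y p^`M(j)) (polyA_laplace r.+1 i).
rewrite /= mderivD mderivM mderivZ mderivXU !mmapD !mmapM mmap_XU yi mul0r addr0.
rewrite mmapZ mmap_polyA_laplace // !rmorph_nat => e.
rewrite [(_ * _)%:R]natrM -[RHS]mulrA [(2%:R - _) * _]mulrC !mulrA.
rewrite -[_ * _ * mmap _ _ _]mulrA -e.
by case: (i =P j) => [<-|_]; rewrite ?mulr1n ?mulr0n; ring.
Qed.

(** On the subspace where all coordinates in the support of [a] vanish, the first
    derivatives of A_{q+1} along this support all take the same value. *)
Lemma mmap_lin_poly y q (a : 'rV[int]_m) : (forall i, a 0 i != 0 -> y i = 0) ->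
  mmap phi y (lin_poly q a) = (q.+1)%:R * (eta a)%:~R * mmap phi y (polyA m q).
Proof.
move=> ya; have q0 : q.+1%:R != 0 :> rat by rewrite pnatr_eq0.
rewrite mmapZ raddf_sum /=.
rewrite (eq_bigr (fun i => (a 0 i)%:~R * ((q.+1 ^ 2)%:R * mmap phi y (polyA m q)))).
  rewrite -mulr_suml -(rmorph_sum (intmul 1)) -/(eta a) mulrCA.
  have : phi (q.+1%:R)^-1 * q.+1%:R = 1.
    by rewrite -[X in _ * X](rmorph_nat phi) -rmorphM mulVf // rmorph1.
  move: (phi _) => c c1; rewrite [(_ ^ _)%:R](natrM _ q.+1 q.+1).
  by rewrite [LHS](_ : _ = c * q.+1%:R * (q.+1%:R * (eta a)%:~R * mmap phi y (polyA m q)));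
    [rewrite c1 mul1r | ring].
move=> i _; rewrite mmapZ rmorph_int.
have [->|/ya yi] := eqVneq (a 0 i) 0; first by rewrite !mul0r.
by rewrite mmap_polyA_laplace.
Qed.

(** For [eta a = 0] this is the linear term of [a(xi)] transversally to the
    subspace where it vanishes. It is proportional to the sum of the [a_i xi_i]. *)
Lemma mmap_deriv_lin_poly y q (a : 'rV[int]_m) i : (forall i, a 0 i != 0 -> y i = 0) ->
  a 0 i != 0 ->
  2%:R * mmap phi y (lin_poly q.+1 a)^`M(i)
  = (q.+2 * q.+1 ^ 2)%:R * (2 * eta a - a 0 i)%:~R * mmap phi y (polyA m q).
Proof.
move=> ya ai; have q0 : q.+2%:R != 0 :> rat by rewrite pnatr_eq0.
rewrite mderivZ mmapZ (raddf_sum (mderiv i)) raddf_sum /= mulrCA mulr_sumr.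
rewrite (eq_bigr (fun j => ((a 0 j) * (2 - (j == i)%:R))%:~R *
    ((q.+2 ^ 2 * q.+1 ^ 2)%:R * mmap phi y (polyA m q)))); last first.
  move=> j _; rewrite mderivZ mmapZ rmorph_int.
  have [->|/ya yj] := eqVneq (a 0 j) 0; first by rewrite !mul0r mulr0.
  rewrite mulrCA (mmap_polyA_laplace2 _ yj (ya i ai)) (rmorphM (intmul 1)) rmorphB /=.
  by rewrite !rmorph_nat; ring.
rewrite -mulr_suml -(rmorph_sum (intmul 1)).
have -> : \sum_j a 0 j * (2 - (j == i)%:R) = 2 * eta a - a 0 i.
  transitivity (\sum_j (2 * a 0 j - (j == i)%:R * a 0 j)).
    by apply: eq_bigr => j _; ring.
  rewrite sumrB -mulr_sumr [X in _ - X](bigD1 i) //= eqxx mul1r.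
  rewrite [X in _ - (_ + X)]big1 ?addr0 => [|j /negPf->]; last by rewrite mul0r.
  by [].
have -> : (q.+2 ^ 2 * q.+1 ^ 2)%:R = q.+2%:R * (q.+2 * q.+1 ^ 2)%:R :> R.
  by rewrite -natrM; congr _%:R; ring.
have : phi (q.+2%:R)^-1 * q.+2%:R = 1.
  by rewrite -[X in _ * X](rmorph_nat phi) -rmorphM mulVf // rmorph1.
move: (phi _) => c c1.
transitivity (c * q.+2%:R * (q.+2 * q.+1 ^ 2)%:R * (2 * eta a - a 0 i)%:~R
   * mmap phi y (polyA m q)); first by ring.
by rewrite c1 mul1r.
Qed.

End Evaluation.

(** * Evaluation in a univariate polynomial ring *)

Section PolyEvaluation.
Variables (m : nat) (R : comNzRingType) (phi : {rmorphism rat -> R}).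
Implicit Types (p : {mpoly rat[m]}) (x : 'I_m -> {poly R}) (k : 'X_{1..m}).

Lemma horner_mmap x p c :
  (mmap (polyC \o phi) x p).[c] = mmap phi (fun i => (x i).[c]) p.
Proof.
rewrite horner_sum; apply: eq_bigr => k _; rewrite hornerM horner_prod /= hornerC.
by congr (_ * _); apply: eq_bigr => i _; rewrite horner_exp.
Qed.

(** The chain rule. Both sides are derivations of [p] over the rationals that agree on
    the variables. *)
Lemma deriv_mmap x p :
  (mmap (polyC \o phi) x p)^`()
    = \sum_i (x i)^`() * mmap (polyC \o phi) x p^`M(i).
Proof.
pose P p := (mmap (polyC \o phi) x p)^`()
    = \sum_i (x i)^`() * mmap (polyC \o phi) x p^`M(i).
have PC c : P c%:MP.
  rewrite /P mmapC /= derivC big1 // => i _.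
  by rewrite mderivC raddf0 mulr0.
have PD p1 p2 : P p1 -> P p2 -> P (p1 + p2).
  rewrite /P mmapD derivD => -> ->; rewrite -big_split; apply: eq_bigr => i _ /=.
  by rewrite mderivD mmapD mulrDr.
have PM p1 p2 : P p1 -> P p2 -> P (p1 * p2).
  rewrite /P mmapM derivM => -> ->; rewrite mulr_suml mulr_sumr -big_split.
  by apply: eq_bigr => i _ /=; rewrite mderivM mmapD !mmapM; ring.
have PX i : P 'X_i.
  rewrite /P mmap_XU (bigD1 i) //= big1 => [|j ji].
    by rewrite mderivXU eqxx rmorph1 mulr1 addr0.
  by rewrite mderivXU eq_sym (negPf ji) raddf0 mulr0.
rewrite -/(P p) [p]mpolyE; apply: (big_ind P) => //; first by rewrite -mpolyC0.
move=> k _; rewrite -mul_mpolyC; apply: (PM) => //.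
rewrite mpolyXE_id; apply: (big_ind P) => [||i _]; [by rewrite -mpolyC1|exact: PM|].
by elim: (k i) => [|n IH]; rewrite ?expr0 ?exprS -?mpolyC1 //; apply: (PM).
Qed.

Lemma mnm_axis k (h : 'I_m) : k h = mdeg k -> k = (U_(h) *+ mdeg k)%MM.
Proof.
move=> kh; apply/mnmP => i; rewrite mulmnE mnm1E; case: (h =P i) => [<-|hi].
  by rewrite mul1n.
have := mdegE k; rewrite (bigD1 h) //= -kh (bigD1 i) /= 1?eq_sym; last exact/eqP.
by move/eqP; rewrite -[X in X == _]addn0 eqn_add2l eq_sym addn_eq0 => /andP[/eqP].
Qed.

Lemma coef_mmap_axis x p q (h : 'I_m) (c : 'I_m -> R) :
  (forall k, mdeg k != q -> p@_k = 0) -> x h = 'X ->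
  (forall i, i != h -> x i = (c i)%:P) ->
  (mmap (polyC \o phi) x p)`_q = phi p@_(U_(h) *+ q)%MM.
Proof.
move=> hom xh xc.
have E k : mmap1 x k = (\prod_(i | i != h) c i ^+ k i) *: 'X^(k h).
  rewrite /mmap1 (bigD1 h) //= xh mulrC -mul_polyC rmorph_prod; congr (_ * _).
  by apply: eq_bigr => i ih; rewrite xc // rmorphXn.
rewrite coef_sum (eq_bigr (fun k => if k == (U_(h) *+ q)%MM then phi p@_k else 0)).
  case: (boolP ((U_(h) *+ q)%MM \in msupp p)) => hin.
    rewrite (bigD1_seq _ hin (msupp_uniq p)) //= eqxx big1 ?addr0 // => k.
    by move/negPf ->.
  rewrite (memN_msupp_eq0 hin) raddf0 big_seq big1 // => k hk.
  by case: eqP => // e; rewrite -e hk in hin.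
move=> k _; rewrite E coefCM coefZ coefXn.
case: (k =P (U_(h) *+ q)%MM) => [->|kq].
  rewrite mulmnE mnm1E eqxx mul1n eqxx mulr1 big1 ?mulr1 // => i ih.
  by rewrite mulmnE mnm1E eq_sym (negPf ih) mul0n expr0.
have [kd|/hom->] := eqVneq (mdeg k) q; last by rewrite raddf0 mul0r.
case: eqP => [kh|_]; last by rewrite !mulr0.
by case: kq; rewrite -kd; apply: mnm_axis; rewrite kd kh.
Qed.

End PolyEvaluation.

Section Homogeneous.
Variables (m : nat).
Implicit Types (k : 'X_{1..m}).

Lemma polyA_hom r k : mdeg k != r -> (polyA m r)@_k = 0.
Proof. by rewrite mcoeff_polyA => /negPf ->. Qed.

Lemma lin_poly_hom q a k : mdeg k != q -> (lin_poly q a)@_k = 0.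
Proof. by rewrite mcoeff_lin_poly => /negPf ->. Qed.

Lemma polyA_axis r (h : 'I_m) : (polyA m r)@_(U_(h) *+ r)%MM = 1.
Proof. by rewrite mcoeff_polyA mdegMn mdeg1 mul1n eqxx multinomial_axis. Qed.

Lemma lin_poly_axis q (a : 'rV[int]_m) h :
  (lin_poly q a)@_(U_(h) *+ q)%MM = q.+1%:R * (eta a)%:~R - q%:R * (a 0 h)%:~R.
Proof.
rewrite mcoeff_lin_poly mdegMn mdeg1 mul1n eqxx multinomial_axis.
rewrite (eq_bigr (fun j => (q.+1%:R * a 0 j - (j == h)%:R * q%:R * a 0 j)%:~R)).
  rewrite -(rmorph_sum (intmul 1)) sumrB -mulr_sumr -/(eta a) (bigD1 h) //=.
  rewrite big1 ?addr0 => [|j /negPf ->]; last by rewrite !mul0r.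
  by rewrite eqxx mul1r rmorphB !rmorphM /= !rmorph_nat.
move=> j _; rewrite muln1 rmorphB !rmorphM /= !rmorph_nat.
have := multinomial_addU (U_(h) *+ q)%MM j.
rewrite mdegMn mdeg1 mul1n multinomial_axis muln1 mulmnE mnm1E eq_sym.
case: eqP => [->|_]; last by rewrite mul0n muln1 => ->; rewrite !mul0r subr0 mulrC.
rewrite mul1n => /eqP; rewrite -{2}[q.+1]mul1n eqn_pmul2r // => /eqP ->.
by rewrite -natr1; ring.
Qed.

End Homogeneous.

(** Up to sign, the difference of the two diagonal entries of the matrix of a graph
    with one edge, for a black or a red edge [l]. *)
Definition edge_diff (red : bool) q m (l : 'rV[int]_m) : {mpoly rat[m]} :=
  if red then lin_poly q l - (2 * q.+1)%:R *: polyA m q else lin_poly q l.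

Lemma edge_diff_hom red q m (l : 'rV[int]_m) k : mdeg k != q -> (edge_diff red q l)@_k = 0.
Proof.
move=> kq; rewrite /edge_diff; case: red; last exact: lin_poly_hom.
by rewrite mcoeffB mcoeffZ polyA_hom // lin_poly_hom // mulr0 subr0.
Qed.

Lemma edge_diff_axis red q m (l : 'rV[int]_m) h : eta l = (if red then - 2 else 0) ->
  (edge_diff red q l)@_(U_(h) *+ q)%MM =
  - (if red then (4 * q.+1)%:Z + q%:Z * l 0 h else q%:Z * l 0 h)%:~R.
Proof.
move=> le; rewrite /edge_diff; case: red le => le.
  by rewrite mcoeffB mcoeffZ polyA_axis lin_poly_axis le rmorphD !PoszM !rmorphM /=; ring.
by rewrite lin_poly_axis le mulr0 sub0r rmorphM.
Qed.

Lemma mmap_polyA_plane m (F : numClosedFieldType) r (h1 h2 : 'I_m)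
    (phi : {rmorphism rat -> {poly F}}) (y : 'I_m -> {poly F}) :
  h1 != h2 -> y h1 = 'X -> y h2 = 1 -> (forall i, i != h1 -> i != h2 -> y i = 0) ->
  mmap phi y (polyA m r) = sqbin_poly F r.
Proof.
move=> h12 y1 y2 y0; pose M j := (U_(h1) *+ j + U_(h2) *+ (r - j))%MM.
have Md (j : 'I_r.+1) : mdeg (M j) = r.
  by rewrite mdegD !mdegMn !mdeg1 !mul1n subnKC // -ltnS.
have M1 j : M j h1 = j.
  by rewrite mnmDE !mulmnE !mnm1E eqxx eq_sym (negPf h12) mul1n addn0.
have M2 j : M j h2 = (r - j)%N.
  by rewrite mnmDE !mulmnE !mnm1E eqxx (negPf h12) mul1n.
have M0 j i : i != h1 -> i != h2 -> M j i = 0%N.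
  by move=> /negPf i1 /negPf i2; rewrite mnmDE !mulmnE !mnm1E ![_ == i]eq_sym i1 i2.
transitivity (mmap phi y (\sum_(j < r.+1) ('C(r, j) ^ 2)%:R *: 'X_[M j])).
  apply: eq_mmap => k ky; rewrite mcoeff_polyA raddf_sum /=.
  have kd : mdeg k = (k h1 + k h2)%N.
    rewrite mdegE (bigD1 h1) //= (bigD1 h2) 1?eq_sym //= big1 ?addn0 // => i.
    by case/andP=> i1 i2; apply/ky/y0.
  case: eqP => [kr|kr]; last first.
    rewrite big1 // => j _; rewrite mcoeffZ mcoeffX; case: eqP => [e|_].
      by case: kr; rewrite -e Md.
    by rewrite mulr0.
  have k1 : (k h1 < r.+1)%N by rewrite ltnS -kr kd leq_addr.
  have kM : k = M (k h1).
    apply/mnmP => i; have [->|i1] := eqVneq i h1; first by rewrite M1.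
    have [->|i2] := eqVneq i h2; first by rewrite M2 -kr kd addKn.
    by rewrite M0 // ky // y0.
  rewrite (bigD1 (Ordinal k1)) //= big1 => [|j jk].
    rewrite mcoeffZ mcoeffX -kM eqxx mulr1 addr0 kM multinomial_disjoint.
      by rewrite !multinomial_axis !mdegMn !mdeg1 !mul1n M1 subnKC.
    move=> i; rewrite !mulmnE !mnm1E; have [<-|//] := eqVneq h1 i.
    by rewrite [h2 == h1]eq_sym (negPf h12) orbT.
  rewrite mcoeffZ mcoeffX kM; case: eqP => [/mnmP/(_ h1)|_]; last by rewrite mulr0.
  by rewrite !M1 => e; move: jk; rewrite -val_eqE /= e eqxx.
rewrite raddf_sum /sqbin_poly poly_def; apply: eq_bigr => j _.
rewrite /= mmapZ rmorph_nat mmapX /mmap1 (bigD1 h1) //= (bigD1 h2) 1?eq_sym //=.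
rewrite y1 y2 expr1n mul1r big1 => [|i /andP[i1 i2]]; last by rewrite M0.
by rewrite M1 mulr1 -mul_polyC polyC_natr.
Qed.

(** * Edge sums and the positive and negative parts of an edge *)

Section EdgeSum.
Variables (m n d : nat) (b c : 'X_{1..m}).
Hypothesis dn : (d < n)%N.

(** The sum over alpha in c(l): for a black edge [b] and [c] are the positive and
    negative parts of [l] and [d = q]; for a red edge [d = q - 1]. *)
Definition edge_sum : {mpoly rat[m]} :=
  \sum_(a : 'X_{1..m < n} | mdeg (a + b)%MM == d)
    (multinomial (c + a)%MM * multinomial (b + a)%MM)%:R *: 'X_[a].

Lemma mcoeff_edge_sum k : edge_sum@_k =
  if mdeg (k + b)%MM == d then
    (multinomial (c + k)%MM * multinomial (b + k)%MM)%:R else 0.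
Proof.
rewrite /edge_sum (mcoeff_sum_bmnm n (fun a => mdeg (a + b)%MM == d)
  (fun a => (multinomial (c + a)%MM * multinomial (b + a)%MM)%:R)).
rewrite (_ : _ && _ = (mdeg (k + b)%MM == d)) //.
case: eqP => [e|]; rewrite ?andbF // andbT.
by apply: leq_ltn_trans dn; rewrite -e mdegD leq_addr.
Qed.

(** If [b] has the largest possible degree, only alpha = 0 remains. *)
Lemma edge_sum_top : mdeg b = d ->
  edge_sum = ((multinomial c * multinomial b)%:R)%:MP.
Proof.
move=> bd; apply/mpolyP => k; rewrite mcoeff_edge_sum mcoeffC mdegD -bd.
rewrite -[X in _ == X]add0n eqn_add2r mdeg_eq0; case: eqP => [->|_].
  by rewrite !addm0 mulr1.
by rewrite mulr0.
Qed.

(** Where the supports of [b] and [c] vanish, only the alpha disjoint from them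
    count, and for these the multinomials split by [multinomial_disjoint]. *)
Lemma mmap_edge_sum (R : comNzRingType) (phi : {rmorphism rat -> R}) y r :
  (forall i, y i = 0 \/ (b i = 0%N /\ c i = 0%N)) -> (mdeg b + r = d)%N ->
  mmap phi y edge_sum =
    ((multinomial c * 'C(mdeg c + r, mdeg c)) *
     (multinomial b * 'C(mdeg b + r, mdeg b)))%:R * mmap phi y (polyA m r).
Proof.
move=> y0 br; rewrite -(rmorph_nat phi) -mmapZ; apply: eq_mmap => k ky.
rewrite mcoeff_edge_sum mcoeffZ mcoeff_polyA mdegD -br addnC eqn_add2l.
case: eqP => [kr|_]; last by rewrite mulr0.
rewrite -[RHS]natrM; congr _%:R; rewrite !multinomial_disjoint ?kr.
- by ring.
- by move=> i; case: (y0 i) => [/ky->|[-> _]]; rewrite ?eqxx ?orbT.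
by move=> i; case: (y0 i) => [/ky->|[_ ->]]; rewrite ?eqxx ?orbT.
Qed.

End EdgeSum.

Section Parts.
Variables (m : nat) (l : 'rV[int]_m).
Let lp := pos_part l.
Let lm := neg_part l.

Lemma parts_sum i : (lp + lm)%MM i = `|(l 0 i)%R|%N.
Proof.
rewrite /lp /lm /neg_part mnmDE !mnmE mxE; move: (l 0 i) => x.
by case: ifP => h1; case: ifP => h2; lia.
Qed.

Lemma parts_sub i : (lp i)%:Z - (lm i)%:Z = l 0 i.
Proof.
rewrite /lp /lm /neg_part !mnmE mxE; move: (l 0 i) => x.
by case: ifP => h1; case: ifP => h2; lia.
Qed.

Lemma parts_eq0 i : l 0 i = 0 -> lp i = 0%N /\ lm i = 0%N.
Proof. by move=> li; rewrite /lp /lm /neg_part !mnmE mxE li. Qed.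

Lemma eta_parts : eta l = (mdeg lp)%:Z - (mdeg lm)%:Z.
Proof.
rewrite !mdegE !(rmorph_sum (Posz : nat -> int)) -sumrB.
by apply: eq_bigr => i _; rewrite parts_sub.
Qed.

Lemma sum_abs_parts : (\sum_i `|(l 0 i)%R|)%N = (mdeg lp + mdeg lm)%N.
Proof. by rewrite -mdegD mdegE; apply: eq_bigr => i _; rewrite parts_sum. Qed.

End Parts.

Lemma edges_sum_abs q m (l : 'rV[int]_m) : l \in edges q ->
  (\sum_i `|(l 0 i)%R| <= 2 * q)%N.
Proof.
case/and4P=> /existsP[f /eqP ->] _ _ _.
apply: (@leq_trans (\sum_i \sum_(j < 2 * q) ((f j).1 == i))%N).
  apply: leq_sum => i _; rewrite summxE.
  elim/big_ind2: _ => [||j _]; first by rewrite absz0.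
    by move=> a1 a2 b1 b2 ab1 ab2; lia.
  rewrite !mxE eqxx /= eq_sym; case: ((f j).2); case: eqP; rewrite ?expr0 ?expr1 //=.
rewrite exchange_big /= -[X in (_ <= X)%N]card_ord -sum1_card.
apply: leq_sum => j _; rewrite (bigD1 (f j).1) //= eqxx big1 // => i.
by rewrite eq_sym => /negPf ->.
Qed.

(** * Specialisations that exclude a square *)

Lemma mmap_sq_sub_sq m (R : comNzRingType) (phi : {rmorphism rat -> R})
    (x : 'I_m -> R) (E B S : {mpoly rat[m]}) c k :
  E ^+ 2 - B ^+ 2 = c *: ('X_[k] * S ^+ 2) ->
  mmap phi x E ^+ 2 - mmap phi x B ^+ 2 = phi c * (mmap1 x k * mmap phi x S ^+ 2).
Proof.
move/(congr1 (mmap phi x)); rewrite mmapB !rmorphXn mmapZ mmapM mmapX.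
by rewrite rmorphXn.
Qed.

Lemma mmap_axis m (R : comNzRingType) (phi : {rmorphism rat -> R}) y q (h : 'I_m)
    (p : {mpoly rat[m]}) :
  (forall k, mdeg k != q -> p@_k = 0) -> y h = 1 -> (forall i, i != h -> y i = 0) ->
  mmap phi y p = phi p@_(U_(h) *+ q)%MM.
Proof.
move=> hom yh y0; transitivity (mmap phi y (p@_(U_(h) *+ q)%MM *: 'X_[(U_(h) *+ q)%MM])).
  apply: eq_mmap => k ky; rewrite mcoeffZ mcoeffX.
  have -> : k = (U_(h) *+ mdeg k)%MM.
    apply: mnm_axis; rewrite mdegE (bigD1 h) //= big1 ?addn0 // => i ih.
    by apply/ky/y0.
  have [->|kr] := eqVneq (mdeg k) q; first by rewrite eqxx mulr1.
  rewrite hom ?mdegMn ?mdeg1 ?mul1n //.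
  case: eqP => [/(congr1 (@mdeg _))|]; last by rewrite mulr0.
  by rewrite !mdegMn !mdeg1 !mul1n => e; rewrite e eqxx in kr.
rewrite mmapZ mmapX /mmap1 big1 ?mulr1 // => i _; rewrite mulmnE mnm1E.
by case: eqP => [<-|_]; rewrite ?yh ?expr1n ?mul0n ?expr0.
Qed.

(** Seen as polynomials in xi_h alone, with all other variables set to 1, the
    right-hand side has degree less than [q] while [B] has a term of degree [q]. *)
Lemma sq_sub_sq_neq_monomial m (q : nat) (E B : {mpoly rat[m]}) (c : rat)
  (k : 'X_{1..m}) (h : 'I_m) :
  (forall j, mdeg j != q -> B@_j = 0) -> B@_(U_(h) *+ q)%MM != 0 ->
  c != 0 -> (k h < q)%N -> E ^+ 2 - B ^+ 2 != c *: 'X_[k].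
Proof.
move=> hom Bh c0 kq; apply/eqP => eEB.
(* A value other than 0 is needed here: the monomial must survive the specialisation. *)
pose x i : {poly rat} := if i == h then 'X else 1.
have {}eEB : E ^+ 2 - B ^+ 2 = c *: ('X_[k] * 1 ^+ 2) by rewrite eEB expr1n mulr1.
have := mmap_sq_sub_sq (polyC \o idfun) x eEB; rewrite rmorph1 expr1n mulr1 /=.
have -> : mmap1 x k = 'X^(k h).
  rewrite /mmap1 (bigD1 h) //= {1}/x eqxx big1 ?mulr1 // => i ih.
  by rewrite /x (negPf ih) expr1n.
rewrite mul_polyC => e.
have sW : size (c *: 'X^(k h)) = (k h).+1 by rewrite size_scale // size_polyXn.
have W0 : c *: 'X^(k h) != 0 by rewrite -size_poly_eq0 sW.
have := sq_sub_sq_small (q := q) (two_neq0 rat) e W0; rewrite sW => /(_ kq)/eqP.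
rewrite (coef_mmap_axis (h := h) (c := fun=> 1) _ hom) /=.
- by apply/negP.
- by rewrite /x eqxx.
by move=> i /negPf ih; rewrite /x ih.
Qed.

(** Only xi_i and xi_j are kept, with xi_j = 1; the constraint is that of
    [sq_sub_sq_X]. *)
Lemma sq_sub_sq_eq_XiXj m (E B : {mpoly rat[m]}) (c : rat) (i j : 'I_m) :
  (forall k, mdeg k != 1%N -> B@_k = 0) -> i != j ->
  E ^+ 2 - B ^+ 2 = c *: 'X_[(U_(i) + U_(j))%MM] -> c != 0 ->
  c = - 4%:R * (B@_(U_(j))%MM * B@_(U_(i))%MM).
Proof.
move=> hom ij eEB c0.
pose x h : {poly rat} := if h == i then 'X else if h == j then 1 else 0.
have {}eEB : E ^+ 2 - B ^+ 2 = c *: ('X_[(U_(i) + U_(j))%MM] * 1 ^+ 2).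
  by rewrite eEB expr1n mulr1.
have := mmap_sq_sub_sq (polyC \o idfun) x eEB; rewrite rmorph1 expr1n mulr1 /=.
rewrite mul_polyC -(mmapX x (polyC \o idfun)) mpolyXD mmapM !mmap_XU.
have xi : x i = 'X by rewrite /x eqxx.
have xj : x j = 1 by rewrite /x eq_sym (negPf ij) eqxx.
rewrite xi xj mulr1 => /(sq_sub_sq_X (two_neq0 rat)) -> //.
rewrite (coef_mmap_axis (h := i) (c := fun h => if h == j then 1 else 0) _ hom).
- rewrite -horner_coef0 horner_mmap (mmap_axis (h := j) _ hom) ?mulm1n //.
    by rewrite xj hornerC.
  by move=> h /negPf hj; rewrite /x hj; case: eqP; rewrite ?hornerX ?hornerC.
- exact: xi.
by move=> h /negPf hi; rewrite /x hi; case: eqP.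
Qed.

Lemma mmap1_parts m (l : 'rV[int]_m) (R : comNzRingType) (x : 'I_m -> {poly R}) w :
  (forall i, l 0 i != 0 -> x i = 'X * (w i)%:P) ->
  mmap1 x (pos_part l + neg_part l)%MM
  = 'X^(mdeg (pos_part l) + mdeg (neg_part l)) * (\prod_i w i ^+ `|(l 0 i)%R|%N)%:P.
Proof.
move=> xw; rewrite -sum_abs_parts -prodrXr rmorph_prod -big_split.
apply: eq_bigr => i _; rewrite parts_sum /=.
have [->|/xw ->] := eqVneq (l 0 i) 0; first by rewrite !expr0 mulr1.
by rewrite exprMn rmorphXn.
Qed.

(** Set xi_i = eps on the support of [l], except xi_i0 = w eps, set xi_h = 1
    and all other variables to 0. Then [B] starts with a multiple of (w - 1) eps, whereas the
    right-hand side starts with a multiple of w^|l_i0| eps^(2k + 2). For [k > 0] the first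
    coefficient would divide the second one, which fails at w = 1. For [k = 0] both have the same
    order in eps, and the difference of squares of the lowest coefficients is governed by
    [sq_sub_sq_X] in the variable w; the constants differ by a factor 4. *)
Lemma black_disc_nonsquare_zero_coord q m (l : 'rV[int]_m) (h i0 : 'I_m) k (E : {mpoly rat[m]}) :
  eta l = 0 -> l 0 h = 0 -> l 0 i0 != 0 ->
  mdeg (pos_part l) = k.+1 -> mdeg (neg_part l) = k.+1 -> (k <= q)%N ->
  E ^+ 2 - edge_diff false q.+1 l ^+ 2 !=
    (4 * q.+2 ^ 2)%:R *: ('X_[(pos_part l + neg_part l)%MM]
      * edge_sum q.+2 q.+1 (pos_part l) (neg_part l) ^+ 2).
Proof.
move=> l0 lh li0 pk nk kq; apply/eqP => eEB.
pose phi : {rmorphism rat -> {poly rat}} := polyC.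
pose w i : {poly rat} := if i == i0 then 'X else 1.
pose x i : {poly {poly rat}} :=
  if i == h then 1 else if l 0 i == 0 then 0 else 'X * (w i)%:P.
have xl i : l 0 i != 0 -> x i = 'X * (w i)%:P.
  move=> li; rewrite /x (negPf li); case: eqP => // ih.
  by rewrite ih lh eqxx in li.
pose y i := (x i).[0].
have yh : y h = 1 by rewrite /y /x eqxx hornerC.
have yl i : l 0 i != 0 -> y i = 0.
  by move=> li; rewrite /y xl // hornerM hornerX mul0r.
have y0 i : i != h -> y i = 0.
  move=> ih; have [li|/yl//] := eqVneq (l 0 i) 0.
  by rewrite /y /x (negPf ih) li eqxx hornerC.
have A1 r : mmap phi y (polyA m r) = 1.
  by rewrite (mmap_axis phi (@polyA_hom m r) yh y0) polyA_axis rmorph1.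
have := mmap_sq_sub_sq (polyC \o phi) x eEB.
rewrite (mmap1_parts xl) pk nk.
set B := mmap _ _ (edge_diff _ _ _); set S := mmap _ _ (edge_sum _ _ _ _) => eEB'.
have [b Bb] : exists b, B = 'X * b.
  apply: poly_root0.
  by rewrite horner_mmap (mmap_lin_poly phi _ yl) l0 mulr0z mulr0 mul0r.
(* As the coordinates of l sum to 0, the sum of the w_i l_i is l_i0 (w - 1). *)
have b0 : 2%:R * b.[0] = - ((q.+2 * q.+1 ^ 2)%:R * (l 0 i0)%:~R) * ('X - 1).
  have -> : b.[0] = B^`().[0] by rewrite Bb derivM derivX !hornerE.
  rewrite deriv_mmap horner_sum mulr_sumr.
  rewrite (eq_bigr (fun i => - (q.+2 * q.+1 ^ 2)%:R * (w i * (l 0 i)%:~R))).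
    rewrite -mulr_sumr (bigD1 i0) //= {1}/w eqxx.
    rewrite (eq_bigr (fun i => (l 0 i)%:~R)) => [|i /negPf ii]; last first.
      by rewrite /w ii mul1r.
    have : (eta l)%:~R = 0 :> {poly rat} by rewrite l0.
    rewrite /eta (bigD1 i0) //= rmorphD /= rmorph_sum /= => /eqP.
    by rewrite addrC addr_eq0 => /eqP ->; ring.
  move=> i _; rewrite hornerM horner_mmap.
  have [li|li] := eqVneq (l 0 i) 0.
    have -> : (x i)^`() = 0.
      by rewrite /x li eqxx; case: eqP; rewrite derivC.
    by rewrite horner0 mul0r li !mulr0.
  rewrite mulrCA (mmap_deriv_lin_poly phi _ yl li) A1 l0 xl // derivM derivX derivC !hornerE.
  by rewrite rmorphN /=; ring.
pose C := ((multinomial (neg_part l) * 'C(q.+1, k.+1)) *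
     (multinomial (pos_part l) * 'C(q.+1, k.+1)))%N.
have S0 : S.[0] = C%:R.
  rewrite horner_mmap (mmap_edge_sum (r := (q - k)%N) (ltnSn _) phi) ?pk ?nk ?addSn ?subnKC //.
    by rewrite A1 mulr1.
  move=> i; have [/parts_eq0[-> ->]|/yl yi] := eqVneq (l 0 i) 0; first by right.
  by left.
have C0 : C%:R != 0 :> rat.
  by rewrite pnatr_eq0 -lt0n !muln_gt0 !multinomial_gt0 !bin_gt0 !ltnS kq.
have wE : \prod_i w i ^+ `|(l 0 i)%R|%N = 'X^`|(l 0 i0)%R|%N.
  rewrite (bigD1 i0) //= {1}/w eqxx big1 ?mulr1 // => i /negPf ii.
  by rewrite /w ii expr1n.
pose V : {poly {poly rat}} :=
  ((4 * q.+2 ^ 2)%:R * 'X^`|(l 0 i0)%R|%N)%:P * S ^+ 2.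
have {}eEB' : mmap (polyC \o phi) x E ^+ 2 - ('X * b) ^+ 2 = 'X^(k.*2.+2) * V.
  rewrite -Bb eEB' wE rmorph_nat /V rmorphM rmorph_nat -addnn -addnS -addSn.
  by move: (_ ^+ _ : {poly {poly rat}}) => u; ring.
have [E1 eE1] := sq_sub_mulX eEB'.
have V0 : V.[0] = (4 * q.+2 ^ 2 * C ^ 2)%:R *: 'X^`|(l 0 i0)%R|%N.
  rewrite /V hornerM hornerC horner_exp S0 -mul_polyC polyC_natr.
  by rewrite -natrX mulrAC -natrM.
pose L : rat := (l 0 i0)%:~R; pose N : rat := (q.+2 * q.+1 ^ 2)%:R.
have L0 : L != 0 by rewrite intr_eq0.
have N0 : N != 0 by rewrite pnatr_eq0 muln_eq0.
have {}b0 : 2%:R * b.[0] = (- (N * L)) *: ('X - 1).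
  by rewrite b0 -mul_polyC rmorphN rmorphM /N /L rmorph_nat rmorph_int.
have nV : (4 * q.+2 ^ 2 * C ^ 2)%:R != 0 :> rat.
  by move: C0; rewrite !pnatr_eq0 !muln_eq0 => /negPf ->.
have [k0|k_gt0] := posnP k; last first.
  have bn0 : b.[0] != 0.
    apply: contra_eq_neq b0 => ->.
    by rewrite mulr0 eq_sym scaler_eq0 oppr_eq0 mulf_eq0 (negPf N0) (negPf L0) polyXsubC_eq0.
  have kE : k.*2 = (k.*2).-1.+1 by rewrite prednK // double_gt0.
  rewrite kE in eE1; have [g] := sq_sub_sq_Xn (poly_two_neq0 _) eE1 bn0.
  rewrite V0 => /(congr1 (fun p => 2%:R * p)); rewrite mulrCA b0 => /(congr1 (horner^~ 1)).
  rewrite -polyC_natr hornerM hornerC hornerZ hornerXn expr1n mulr1.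
  rewrite hornerM hornerZ hornerD hornerN hornerX hornerC subrr !mulr0 => /eqP.
  by rewrite mulf_eq0 (negPf (two_neq0 _)) (negPf nV).
move: eE1; rewrite k0 expr0 mul1r => /(congr1 (horner^~ 0)).
rewrite hornerD hornerN !horner_exp V0.
have /mdeg1P[i /eqP pi] : mdeg (pos_part l) == 1%N by rewrite pk k0.
have /mdeg1P[j /eqP nj] : mdeg (neg_part l) == 1%N by rewrite nk k0.
have L1 : L ^+ 2 = 1 /\ `|(l 0 i0)%R|%N = 1%N.
  move: li0; rewrite /L -(parts_sub l i0) pi nj !mnm1E.
  by case: (i == i0); case: (j == i0).
have -> : C = (q.+1 ^ 2)%N.
  by rewrite /C pi nj k0 !multinomialU !mul1n bin1.
rewrite L1.2 expr1 => /(sq_sub_sq_X (two_neq0 _)).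
have c0 : 2%:R * b.[0]`_0 = N * L.
  rewrite mulr_natl -coefMn -mulr_natl b0 coefZ coefB coefX coef1 /=.
  by ring.
have c1 : 2%:R * b.[0]`_1 = - (N * L).
  rewrite mulr_natl -coefMn -mulr_natl b0 coefZ coefB coefX coef1 /=.
  by ring.
have nV0 : (4 * q.+2 ^ 2 * (q.+1 ^ 2) ^ 2)%:R = 4%:R * N ^+ 2 :> rat.
  by rewrite /N -natrX -natrM; congr _%:R; ring.
rewrite nV0 => e.
have {}e : 4%:R * N ^+ 2 = - ((2%:R * b.[0]`_0) * (2%:R * b.[0]`_1)).
  by rewrite e ?mulf_neq0 ?expf_neq0 //; ring.
(* The two sides of e are 4 N^2 and N^2. *)
have /eqP : 3%:R * N ^+ 2 = 0.
  rewrite -[RHS](subrr (4%:R * N ^+ 2)) {2}e c0 c1.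
  have -> : - (N * L * - (N * L)) = N ^+ 2 * L ^+ 2 by ring.
  by rewrite L1.1; ring.
by rewrite mulf_eq0 expf_eq0 (negPf N0) andbF orbF.
Qed.

(** Set xi_i = eps on the support of [l], xi_h1 = s, xi_h2 = 1 and all
    other variables to 0. At eps = 0 the polynomial [B] is a multiple of A_{q+1}(s, 1), and the
    lowest coefficient of the right-hand side is one of A_{q-k}(s, 1)^2, so that [sq_sub_sq_Xn]
    contradicts [sqbin_dvd]. The roots of A_{q+1}(s, 1) are the reason for working over the
    algebraic numbers. *)
Lemma red_disc_nonsquare_zero_coords q m (l : 'rV[int]_m) (h1 h2 : 'I_m) k (E : {mpoly rat[m]}) :
  eta l = - 2 -> h1 != h2 -> l 0 h1 = 0 -> l 0 h2 = 0 ->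
  mdeg (pos_part l) = k -> mdeg (neg_part l) = k.+2 -> (k <= q)%N ->
  E ^+ 2 - edge_diff true q.+1 l ^+ 2 !=
    (- (4 * q.+1 ^ 2)%:R) *: ('X_[(pos_part l + neg_part l)%MM]
      * edge_sum q.+2 q (pos_part l) (neg_part l) ^+ 2).
Proof.
move=> l2 h12 lh1 lh2 pk nk kq; apply/eqP => eEB.
pose F : numClosedFieldType := algC.
pose phi : {rmorphism rat -> {poly F}} := polyC \o ratr.
pose x i : {poly {poly F}} :=
  if l 0 i == 0 then
    if i == h1 then 'X%:P else if i == h2 then 1 else 0
  else 'X.
have xl i : l 0 i != 0 -> x i = 'X * (1)%:P.
  by move=> li; rewrite /x (negPf li) mulr1.
pose y i := (x i).[0].
have y1 : y h1 = 'X by rewrite /y /x lh1 !eqxx hornerC.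
have y2 : y h2 = 1 by rewrite /y /x lh2 eqxx eq_sym (negPf h12) eqxx hornerC.
have yl i : l 0 i != 0 -> y i = 0.
  by move=> li; rewrite /y xl // hornerM hornerX mul0r.
have y0 i : i != h1 -> i != h2 -> y i = 0.
  move=> /negPf ih1 /negPf ih2; have [li|/yl//] := eqVneq (l 0 i) 0.
  by rewrite /y /x ih1 ih2 li eqxx hornerC.
have A1 r : mmap phi y (polyA m r) = sqbin_poly F r.
  exact: mmap_polyA_plane h12 y1 y2 y0.
have := mmap_sq_sub_sq (polyC \o phi) x eEB.
rewrite (mmap1_parts xl) pk nk.
set B := mmap _ _ (edge_diff _ _ _); set S := mmap _ _ (edge_sum _ _ _ _) => eEB'.
have B0 : B.[0] = (- (4 * q.+2)%:R) *: sqbin_poly F q.+1.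
  rewrite horner_mmap mmapB (mmap_lin_poly phi _ yl) mmapZ !A1 l2 rmorph_nat.
  rewrite -mul_polyC rmorphN rmorph_nat !natrM rmorphN /= rmorphM !rmorph_nat.
  by ring.
pose C := ((multinomial (neg_part l) * 'C(q.+2, k.+2)) *
     (multinomial (pos_part l) * 'C(q, k)))%N.
have S0 : S.[0] = C%:R *: sqbin_poly F (q - k).
  rewrite horner_mmap (mmap_edge_sum (r := (q - k)%N) (leqnSn _) phi) ?pk ?nk ?addSn ?subnKC //.
    by rewrite A1 scaler_nat mulr_natl.
  move=> i; have [/parts_eq0[-> ->]|/yl yi] := eqVneq (l 0 i) 0; first by right.
  by left.
have C0 : (0 < C)%N.
  by rewrite !muln_gt0 !multinomial_gt0 !bin_gt0 !ltnS kq.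
pose c : F := - (4 * q.+1 ^ 2)%:R.
pose V : {poly {poly F}} := c%:P%:P * S ^+ 2.
have {}eEB' : mmap (polyC \o phi) x E ^+ 2 - B ^+ 2 = 'X^((k + k.+1).+1) * V.
  rewrite eEB' big1 => [|i _]; last by rewrite expr1n.
  rewrite /V /c !rmorphN !rmorph_nat -addnS.
  by move: (_ ^+ _ : {poly {poly F}}) => u; ring.
have [|g] := sq_sub_sq_Xn (poly_two_neq0 _) eEB'.
  by rewrite B0 scaler_eq0 oppr_eq0 pnatr_eq0 muln_eq0 /= -size_poly_eq0 size_sqbin.
have -> : V.[0] = (c * C%:R ^+ 2) *: sqbin_poly F (q - k) ^+ 2.
  by rewrite /V hornerM hornerC horner_exp S0 exprZn mul_polyC scalerA.
rewrite B0 => e.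
have c0 : c * C%:R ^+ 2 != 0.
  rewrite mulf_neq0 ?expf_neq0 ?pnatr_eq0 -?lt0n //.
  by rewrite oppr_eq0 pnatr_eq0 muln_eq0.
have /(sqbin_dvd c0) : sqbin_poly F q.+1 %| (c * C%:R ^+ 2) *: sqbin_poly F (q - k) ^+ 2.
  by rewrite e -mul_polyC mulrA dvdp_mull.
by rewrite leqNgt ltnS leq_subr.
Qed.

(** * The discriminant is not a square *)

Lemma zero_coords m (l : 'rV[int]_m) :
  (m <= #|[set i | (l 0 i == 0)%R]| + \sum_i `|(l 0 i)%R|)%N.
Proof.
have <- : (\sum_i (l 0 i == 0)%R)%N = #|[set i | (l 0 i == 0)%R]|.
  rewrite -sum1_card [RHS]big_mkcond /=; apply: eq_bigr => i _.
  by rewrite inE; case: eqP.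
rewrite -big_split -[X in (X <= _)%N]card_ord -sum1_card /=.
by apply: leq_sum => i _; rewrite -absz_eq0; case: (`|_|%N).
Qed.

Lemma small_coord m (l : 'rV[int]_m) :
  (0 < m)%N -> (\sum_i `|(l 0 i)%R| <= m)%N -> exists h, (`|(l 0 h)%R| <= 1)%N.
Proof.
move=> m0 lm; apply/existsP; apply: contraTT lm; rewrite negb_exists -ltnNge => /forallP l2.
apply: (@leq_trans (\sum_(i < m) 2)%N).
  by rewrite sum_nat_const card_ord muln2 -addnn -ltn_subLR ?subnn.
by apply: leq_sum => i _; rewrite ltnNge.
Qed.

Lemma edges_neq0 q m (l : 'rV[int]_m) : l \in edges q -> l != 0.
Proof. by case/and4P. Qed.

Lemma edges_neq2 q m (l : 'rV[int]_m) i : l \in edges q -> l != - (basis_vec i *+ 2).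
Proof. by case/and4P=> _ _ /forallP. Qed.

Lemma natr_sqr_neq0 (a b : nat) : (0 < a)%N -> (0 < b)%N ->
  a%:R * b%:R ^+ 2 != 0 :> rat.
Proof. by move=> a0 b0; rewrite mulf_neq0 ?expf_neq0 ?pnatr_eq0 -?lt0n. Qed.

Lemma scale_edge_sum_top m (q n d : nat) (b c' k : 'X_{1..m}) (a : rat) :
  (d < n)%N -> mdeg b = d ->
  a *: ('X_[k] * edge_sum n d b c' ^+ 2)
   = (a * (multinomial c' * multinomial b)%:R ^+ 2) *: 'X_[k].
Proof.
move=> dn bd; rewrite edge_sum_top //.
by rewrite -rmorphXn mulrC mul_mpolyC scalerA.
Qed.

(** If no coordinate of [l] vanishes then, as the absolute values of at least [2 q]
    coordinates sum to at most [2 q], they are all equal to 1. *)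
Lemma black_disc_nonsquare q m (l : 'rV[int]_m) (E : {mpoly rat[m]}) :
  (0 < q)%N -> (2 * q <= m)%N -> l \in edges q -> eta l = 0 ->
  E ^+ 2 - edge_diff false q l ^+ 2 !=
    (4 * q.+1 ^ 2)%:R *: ('X_[(pos_part l + neg_part l)%MM]
      * edge_sum q.+1 q (pos_part l) (neg_part l) ^+ 2).
Proof.
case: q => // q _ qm le l0.
have sl := edges_sum_abs le; rewrite sum_abs_parts in sl.
have pn : mdeg (pos_part l) = mdeg (neg_part l).
  by have := eta_parts l; rewrite l0; lia.
rewrite pn in sl.
case nk : (mdeg (neg_part l)) => [|k]; rewrite nk in pn sl.
  case/negP: (edges_neq0 le); apply/eqP.
  apply/rowP => i; rewrite mxE -parts_sub.
  move/eqP: nk; move/eqP: pn; rewrite !mdeg_eq0 => /eqP -> /eqP ->.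
  by rewrite !mnm0E.
have kq : (k <= q)%N by lia.
have [i0 li0] : exists i, l 0 i != 0.
  apply/existsP; apply: contraR (edges_neq0 le).
  rewrite negb_exists => /forallP li; apply/eqP/rowP => i; rewrite mxE.
  by apply/eqP; have := li i; rewrite negbK.
case: (pickP [pred i | l 0 i == 0]) => [h /eqP lh|nz].
  exact: black_disc_nonsquare_zero_coord lh li0 pn nk kq.
have z0 : #|[set i | (l 0 i == 0)%R]| = 0%N.
  by apply: eq_card0 => i; rewrite inE; apply: nz.
have := zero_coords l; rewrite z0 add0n sum_abs_parts pn nk => ml.
have kq' : k = q by lia.
have l1 i : `|(l 0 i)%R|%N = 1%N.
  have li : (0 < `|(l 0 i)%R|)%N by rewrite absz_gt0; apply/negbT/nz.
  have := sum_abs_parts l; rewrite pn nk (bigD1 i) //=.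
  suff : (m.-1 <= \sum_(j | j != i) `|(l 0 j)%R|)%N.
    by move: li (\sum_(j | _) _)%N; move: (`|_|%N) => a a0 b; clear -a0 qm ml kq'; lia.
  rewrite -[m in m.-1]card_ord -(cardC1 i) -sum1_card.
  by apply: leq_sum => j _; rewrite absz_gt0; apply/negbT/nz.
rewrite scale_edge_sum_top ?ltnSn ?pn ?kq' //.
set c := _ * _ ^+ 2.
have c0 : c != 0 by rewrite natr_sqr_neq0 ?muln_gt0 ?multinomial_gt0.
have B0 h := edge_diff_axis (red := false) q.+1 h l0.
have [q0|q_gt0] := posnP q; last first.
  have m0 : (0 < m)%N by lia.
  pose h : 'I_m := Ordinal m0.
  apply: (sq_sub_sq_neq_monomial (h := h) _ (@edge_diff_hom false q.+1 m l)) => //.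
  - by rewrite B0 oppr_eq0 intr_eq0 mulf_neq0 // -absz_eq0 l1.
  - by rewrite parts_sum l1.
subst k q.
have /mdeg1P[i /eqP pi] : mdeg (pos_part l) == 1%N by rewrite pn.
have /mdeg1P[j /eqP nj] : mdeg (neg_part l) == 1%N by rewrite nk.
have lE h : l 0 h = (i == h)%:Z - (j == h)%:Z by rewrite -parts_sub pi nj !mnm1E.
have ij : i != j.
  by apply/eqP => ij; move: li0; rewrite lE ij subrr eqxx.
apply/eqP => eEB; rewrite {1}pi {1}nj in eEB.
have := sq_sub_sq_eq_XiXj (@edge_diff_hom false 1 m l) ij eEB c0.
have := B0 i; have := B0 j; rewrite !mulm1n => -> ->.
rewrite /c pi nj !lE !eqxx (negPf ij) eq_sym (negPf ij).
by rewrite !multinomialU.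
Qed.

(** The absolute values of the coordinates of [l] sum to [2 k + 2], with [k] the degree
    of the positive part. Either this leaves two zero coordinates among at least [2 q], or
    [k = q - 1] and the edge sum is constant. *)
Lemma red_disc_nonsquare q m (l : 'rV[int]_m) (E : {mpoly rat[m]}) :
  (0 < q)%N -> (2 * q <= m)%N -> l \in edges q -> eta l = - 2 ->
  E ^+ 2 - edge_diff true q l ^+ 2 !=
    (- (4 * q ^ 2)%:R) *: ('X_[(pos_part l + neg_part l)%MM]
      * edge_sum q.+1 q.-1 (pos_part l) (neg_part l) ^+ 2).
Proof.
case: q => // q _ qm le l2; rewrite -[q.+1.-1]/q.
have [k pk] : exists k, mdeg (pos_part l) = k by exists (mdeg (pos_part l)).
have sl := edges_sum_abs le; rewrite sum_abs_parts in sl.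
have nk : mdeg (neg_part l) = k.+2.
  by have := eta_parts l; rewrite l2 pk; lia.
rewrite pk nk in sl; have kq : (k <= q)%N by lia.
have [klt|kge] := ltnP k q.
  have : (1 < #|[set i | (l 0 i == 0)%R]|)%N.
    by have := zero_coords l; rewrite sum_abs_parts pk nk; lia.
  case/card_gt1P => h1 [h2]; rewrite !inE => -[/eqP lh1 /eqP lh2 h12].
  exact: red_disc_nonsquare_zero_coords l2 h12 lh1 lh2 pk nk kq.
have kE : k = q by apply/eqP; rewrite eqn_leq kq.
rewrite {k kq}kE in pk nk sl kge *; rewrite scale_edge_sum_top ?leqnSn //.
set c := _ * _ ^+ 2.
have c0 : c != 0.
  by rewrite /c mulNr oppr_eq0 natr_sqr_neq0 ?muln_gt0 ?multinomial_gt0 ?expn_gt0.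
have B0 h := edge_diff_axis (red := true) q.+1 h l2.
have m0 : (0 < m)%N by lia.
have [q0|q_gt0] := posnP q; last first.
  have [|h lh] := @small_coord m l m0; first by rewrite sum_abs_parts pk nk; lia.
  apply: (sq_sub_sq_neq_monomial (h := h) _ (@edge_diff_hom true q.+1 m l)) => //.
  - by rewrite B0 oppr_eq0 intr_eq0; move: (l 0 h) lh => a; nia.
  - by rewrite parts_sum; apply: leq_ltn_trans lh _.
move: pk nk; subst q => pk nk.
have p0 : pos_part l = 0%MM by apply/eqP; rewrite -mdeg_eq0 pk.
have [i [j nij]] : exists i j, neg_part l = (U_(i) + U_(j))%MM.
  have [i ni] : exists i, neg_part l i != 0%N.
    apply/existsP; apply: contra_eqT nk; rewrite negb_exists => /forallP n0.
    by rewrite mdegE big1 // => i _; apply/eqP; have := n0 i; rewrite negbK.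
  have Ui : (U_(i) <= neg_part l)%MM by rewrite lep1mP.
  have : mdeg (neg_part l - U_(i))%MM == 1%N.
    by have := congr1 (@mdeg _) (submK Ui); rewrite mdegD mdeg1 nk; lia.
  by case/mdeg1P => j /eqP ej; exists j, i; rewrite -ej submK.
have lE h : l 0 h = - ((i == h)%:Z + (j == h)%:Z).
  by rewrite -parts_sub p0 nij mnmDE !mnm1E mnm0E sub0r PoszD.
have ij : i != j.
  apply/eqP => ij; have /eqP[] := edges_neq2 i le.
  apply/rowP => h; rewrite lE !mxE -ij eqxx /= eq_sym.
  by case: (h == i); ring.
apply/eqP => eEB; rewrite {1}p0 {1}nij add0m in eEB.
have := sq_sub_sq_eq_XiXj (@edge_diff_hom true 1 m l) ij eEB c0.
have := B0 i; have := B0 j; rewrite !mulm1n => -> ->.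
rewrite /c p0 nij !lE !eqxx (negPf ij) eq_sym (negPf ij) multinomial0.
rewrite multinomial_disjoint ?multinomialU ?mdeg1; last first.
  by move=> h; rewrite !mnm1E; have [<-|//] := eqVneq i h; rewrite [j == i]eq_sym (negPf ij).
by [].
Qed.

(** * Monic quadratics, integral polynomials and the squared edge coefficient *)

(** The leading coefficients of two factors are inverse to each other, so a factor
    of degree 0 is a unit; and if (a1 t + a0)(b1 t + b0) is monic, then the discriminant is the
    square of a1 b0 - a0 b1. *)
Lemma monic_quadratic_irreducible (R : idomainType) (t d : R) :
  (forall E, E ^+ 2 != t ^+ 2 - 4%:R * d) ->
  irreducible_elt ('X^2 - t *: 'X + d%:P).
Proof.
move=> nsq; set p := _ + _.
have p_coef i : p`_i = (i == 2)%:R - t * (i == 1)%:R + d * (i == 0)%:R.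
  rewrite /p !(coefD, coefN, coefZ, coefXn, coefX, coefC).
  by case: (i == 0%N); rewrite ?mulr1 ?mulr0.
have p0 : p`_0 = d by rewrite p_coef /=; ring.
have p1 : p`_1 = - t by rewrite p_coef /=; ring.
have p2 : p`_2 = 1 by rewrite p_coef /=; ring.
have sp : size p = 3.
  apply/eqP; rewrite eqn_leq; apply/andP; split.
    by apply/leq_sizeP => -[|[|[|i]]] // _; rewrite p_coef /=; ring.
  by rewrite ltnNge; apply: contra_neqN (oner_neq0 R) => s2; rewrite -p2 nth_default.
have pn0 : p != 0 by rewrite -size_poly_gt0 sp.
split=> //; first by rewrite poly_unitE sp.
move=> a b pab.
have [a0 b0] : a != 0 /\ b != 0 by move: pn0; rewrite pab mulf_eq0 negb_or => /andP.
have sab : (size a + size b = 4)%N.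
  have := size_mul a0 b0; rewrite -pab sp.
  by move: a0 b0; rewrite -!size_poly_gt0; lia.
have lead1 : lead_coef a * lead_coef b = 1.
  by rewrite -lead_coefM -pab lead_coefE sp.
have unit_of (u v : {poly R}) : size u = 1%N -> lead_coef u * lead_coef v = 1 ->
    u \is a GRing.unit.
  move=> u1 uv; have u0 : u`_0 = lead_coef u by rewrite lead_coefE u1.
  by rewrite poly_unitE u1 eqxx /= u0; apply/unitrPr; exists (lead_coef v).
have [sa|sb] : size a = 1%N \/ (size b = 1%N \/ size a = 2 /\ size b = 2).
- by move: a0 b0; rewrite -!size_poly_gt0; lia.
- by left; apply: unit_of lead1.
case: sb => [sb|[sa sb]]; first by right; apply: unit_of sb _; rewrite mulrC; exact: lead1.
have lin (u : {poly R}) : size u = 2 -> u = u`_1 *: 'X + (u`_0)%:P.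
  move=> u2; apply/polyP => i; rewrite coefD coefZ coefX coefC.
  case: i => [|[|i]] /=; rewrite ?mulr0 ?mulr1 ?add0r ?addr0 //.
  by rewrite nth_default // u2.
have := p0; have := p1; have := p2; rewrite pab (lin a sa) (lin b sb).
have -> : (a`_1 *: 'X + (a`_0)%:P) * (b`_1 *: 'X + (b`_0)%:P) =
    (a`_1 * b`_1) *: 'X^2 + (a`_1 * b`_0 + a`_0 * b`_1) *: 'X + (a`_0 * b`_0)%:P.
  by rewrite -!mul_polyC !(polyCM, polyCD); ring.
rewrite !(coefD, coefZ, coefXn, coefX, coefC) /= !(mulr0, mulr1, addr0, add0r).
move=> e2 e1 e0; have /eqP[] := nsq (a`_1 * b`_0 - a`_0 * b`_1).
rewrite -e0 -[t]opprK -e1 sqrrN.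
have -> : (a`_1 * b`_0 - a`_0 * b`_1) ^+ 2 =
   (a`_1 * b`_0 + a`_0 * b`_1) ^+ 2 - 4%:R * (a`_0 * b`_0) * (a`_1 * b`_1) by ring.
by rewrite e2 mulr1.
Qed.

(** Membership in the image of Z[xi], stated with a witness because the required
    polynomial over Z has to be assembled from such witnesses. *)
Definition integral m (p : {mpoly rat[m]}) := exists P : {mpoly int[m]}, map_mpoly intr P = p.

Section Integral.
Variable m : nat.
Implicit Types p : {mpoly rat[m]}.

Lemma integral_sum_bmnm n (P : pred 'X_{1..m}) (F : 'X_{1..m} -> int) p :
  (forall k, p@_k = if (mdeg k < n)%N && P k then (F k)%:~R else 0) -> integral p.
Proof.
move=> pE; exists (\sum_(a : 'X_{1..m < n} | P a) F a *: 'X_[a]).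
rewrite raddf_sum /= (eq_bigr (fun a : 'X_{1..m < n} => (F a)%:~R *: 'X_[a])).
  by apply/mpolyP => k; rewrite pE (mcoeff_sum_bmnm n P (fun a => (F a)%:~R)).
by move=> a _; rewrite map_mpolyZ map_mpolyX.
Qed.

Lemma integralD p1 p2 : integral p1 -> integral p2 -> integral (p1 + p2).
Proof. by move=> [P1 <-] [P2 <-]; exists (P1 + P2); rewrite rmorphD. Qed.

Lemma integralN p : integral p -> integral (- p).
Proof. by move=> [P <-]; exists (- P); rewrite rmorphN. Qed.

Lemma integralM p1 p2 : integral p1 -> integral p2 -> integral (p1 * p2).
Proof. by move=> [P1 <-] [P2 <-]; exists (P1 * P2); rewrite rmorphM. Qed.

Lemma integralZ n p : integral p -> integral (n%:R *: p).
Proof. by move=> [P <-]; exists (n%:R *: P); rewrite map_mpolyZ rmorph_nat. Qed.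

Lemma integralX (k : 'X_{1..m}) : integral 'X_[k].
Proof. by exists 'X_[k]; rewrite map_mpolyX. Qed.

Lemma integral_polyA r : integral (polyA m r).
Proof.
apply: (@integral_sum_bmnm r.+1 (fun k => mdeg k == r) (fun k => (multinomial k ^ 2)%N%:Z)).
move=> k; rewrite mcoeff_polyA -pmulrn (_ : _ && _ = (mdeg k == r)) //.
by case: eqP => [->|]; rewrite ?ltnSn ?andbF.
Qed.

Lemma integral_lin_poly q a : integral (lin_poly q a : {mpoly rat[m]}).
Proof.
apply: (@integral_sum_bmnm q.+1 (fun k => mdeg k == q) (fun k =>
  \sum_j a 0 j * (multinomial (k + U_(j))%MM * multinomial k)%N%:Z)).
move=> k; rewrite mcoeff_lin_poly (_ : _ && _ = (mdeg k == q)).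
  case: eqP => // _; rewrite rmorph_sum; apply: eq_bigr => j _.
  by rewrite rmorphM /= -pmulrn.
by case: eqP => [->|]; rewrite ?ltnSn ?andbF.
Qed.

Lemma integral_edge_sum n d (b c : 'X_{1..m}) : (d < n)%N -> integral (edge_sum n d b c).
Proof.
move=> dn; apply: (@integral_sum_bmnm d.+1 (fun k => mdeg (k + b)%MM == d)
  (fun k => (multinomial (c + k)%MM * multinomial (b + k)%MM)%N%:Z)).
move=> k; rewrite mcoeff_edge_sum // (_ : _ && _ = (mdeg (k + b)%MM == d)) -?pmulrn //.
by case: eqP => [<-|]; rewrite ?andbF // andbT mdegD ltnS leq_addr.
Qed.

End Integral.

Section Substitution.
Variable m : nat.

Lemma in_sqrtX (k : 'X_{1..m}) : in_sqrt 'X_[k] = 'X_[k] ^+ 2.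
Proof.
rewrite /in_sqrt comp_mpolyX [X in _ = X ^+ 2]mpolyXE_id -prodrXl.
by apply: eq_bigr => i _; rewrite tnth_mktuple -!exprM mulnC.
Qed.

Lemma in_sqrtM : {morph @in_sqrt m : p1 p2 / p1 * p2}.
Proof. exact: rmorphM. Qed.

End Substitution.

(** The square of c(l): it has no half-integer powers, so it can be written before
    the substitution of squares for the variables. *)
Definition coef_sq q m (l : 'rV[int]_m) : {mpoly rat[m]} :=
  let lp := pos_part l in let lm := neg_part l in
  if eta l == 0 then (q.+1 ^ 2)%:R *: ('X_[(lp + lm)%MM] * edge_sum q.+1 q lp lm ^+ 2)
  else (q ^ 2)%:R *: ('X_[(lp + lm)%MM] * edge_sum q.+1 q.-1 lp lm ^+ 2).

Lemma edge_coef_sq q m (l : 'rV[int]_m) : l \in edges q ->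
  edge_coef q l ^+ 2 = in_sqrt (coef_sq q l).
Proof.
move=> le; rewrite /edge_coef /coef_sq.
rewrite -[l \in black_edges q]/((l \in edges q) && (eta l == 0)).
rewrite -[l \in red_edges q]/((l \in edges q) && (eta l == - 2)) le /=.
have sq (a : nat) k (S : {mpoly rat[m]}) :
    (a%:R *: ('X_[k] * in_sqrt S)) ^+ 2 = in_sqrt ((a ^ 2)%:R *: ('X_[k] * S ^+ 2)).
  rewrite exprZn exprMn -natrX -in_sqrtX -[in_sqrt S ^+ 2]in_sqrtM -in_sqrtM.
  by rewrite /in_sqrt comp_mpolyZ.
case: eqP => [l0|/eqP ln0].
  rewrite -sq /black_coef; congr ((_ *: (_ * in_sqrt _)) ^+ 2).
  by apply: eq_bigr => a _; rewrite mulnC.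
have -> : eta l == - 2 by case/and4P: le => _ _ _; rewrite (negPf ln0).
by rewrite -sq.
Qed.

Lemma edgesN q m (l : 'rV[int]_m) : l \in edges q -> eta l = 0 -> - l \in edges q.
Proof.
move=> le l0; have e0 : eta (- l) = 0.
  by rewrite -[RHS]oppr0 -l0 /eta -sumrN; apply: eq_bigr => i _; rewrite mxE.
apply/and4P; split; last by rewrite e0 eqxx.
- case/and4P: le => /existsP[f /eqP lE] _ _ _.
  apply/existsP; exists [ffun j => ((f j).1, ~~ (f j).2)].
  rewrite {1}lE -sumrN; apply/eqP; apply: eq_bigr => j _; rewrite ffunE /=.
  by rewrite -scaleNr; congr (_ *: _); case: (f j).2; rewrite ?expr0 ?expr1 ?opprK.
- by rewrite oppr_eq0 (edges_neq0 le).
apply/forallP => i; apply: contra_eq_neq e0 => ->.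
rewrite /eta (bigD1 i) //= big1 => [|j ji]; rewrite !mxE ?eqxx //.
by rewrite (negPf ji).
Qed.

(** * The matrix of a graph with one edge *)

Lemma char_poly_mx2 (R : comNzRingType) (M : 'M[R]_2) :
  char_poly M = 'X^2 - (M 0 0 + M 1 1) *: 'X + (M 0 0 * M 1 1 - M 0 1 * M 1 0)%:P.
Proof.
rewrite /char_poly (expand_det_row _ 0) !big_ord_recl big_ord0 addr0.
rewrite /cofactor !det_mx11 !mxE /= -mul_polyC.
(* The indices left by the Laplace expansion along the first row. *)
have -> : lift 0 0 = 1 :> 'I_2 by apply: val_inj.
have -> : lift 1 0 = 0 :> 'I_2 by apply: val_inj.
rewrite !mulr1n !mulr0n expr0 expr1 !(polyCD, polyCN, polyCM).
ring.
Qed.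

Lemma map_poly_quadratic (R S : comNzRingType) (f : {rmorphism R -> S}) (t d : R) :
  map_poly f ('X^2 - t *: 'X + d%:P) = 'X^2 - f t *: 'X + (f d)%:P.
Proof. by rewrite rmorphD rmorphB /= map_polyXn map_polyZ map_polyX map_polyC. Qed.

Lemma rmorph_disc (R S : comNzRingType) (f : {rmorphism R -> S}) (a b s : R) :
  f ((a + b) ^+ 2 - 4%:R * (a * b - s)) = (f a - f b) ^+ 2 + 4%:R * f s.
Proof.
by rewrite rmorphB rmorphXn rmorphD rmorphM rmorph_nat rmorphB rmorphM; ring.
Qed.

Lemma edges_eta q m (l : 'rV[int]_m) : l \in edges q -> eta l = 0 \/ eta l = - 2.
Proof. by case/and4P=> _ _ _ /orP[] /eqP; [left|right]. Qed.

Definition diag_poly q m (u : zsd m) : {mpoly rat[m]} :=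
  if u.2 then - lin_poly q u.1 + (2 * q.+1)%:R *: polyA m q else lin_poly q u.1.

Lemma integral_diag q m (u : zsd m) : integral (diag_poly q u).
Proof.
rewrite /diag_poly; case: u.2; last exact: integral_lin_poly.
by apply: integralD; [apply/integralN/integral_lin_poly | apply/integralZ/integral_polyA].
Qed.

Lemma integral_coef_sq q m (l : 'rV[int]_m) : integral (coef_sq q l).
Proof.
rewrite /coef_sq; case: ifP => _; apply: integralZ; apply: integralM;
  try exact: integralX.
all: rewrite [_ ^+ 2]expr2; apply: integralM; apply: integral_edge_sum.
all: by rewrite ltnS ?leq_pred.
Qed.

Lemma mark_joined q m (l : 'rV[int]_m) u v : joined q l u v ->
  mark u v = l /\ mark v u = (if eta l == - 2 then l else - l).
Proof.
case/andP=> _ /eqP ->; rewrite /mark mulgK invgM mulVKg; split=> //.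
rewrite -[(edge_elt l)^-1%g]/(zsd_inv (edge_elt l)) /zsd_inv /edge_elt /=.
by case: (_ == _); rewrite ?expr1 ?expr0 ?scaleN1r ?opprK ?scale1r.
Qed.

Lemma joined_sym q m (l : 'rV[int]_m) u v : joined q l u v ->
  joined q (mark v u) v u.
Proof.
move=> juv; have [_ ->] := mark_joined juv.
case/andP: juv => le /eqP ->; apply/andP.
case: (eqVneq (eta l) (- 2)) => [l2|ln2].
  split=> //; apply/eqP; rewrite mulgA -[LHS]mul1g; congr (_ * _)%g.
  by rewrite /edge_elt l2 eqxx -[RHS]/(zsd_mul _ _) /zsd_mul /= expr1 scaleN1r subrr.
have l0 : eta l = 0 by have [//|l2] := edges_eta le; rewrite l2 eqxx in ln2.
split; first exact: edgesN.
have eN : eta (- l) = 0.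
  by rewrite /eta (eq_bigr _ (fun i _ => mxE _ _ _ _)) sumrN -/(eta l) l0 oppr0.
apply/eqP; rewrite mulgA -[LHS]mul1g; congr (_ * _)%g.
by rewrite /edge_elt l0 eN -[RHS]/(zsd_mul _ _) /zsd_mul /= expr0 scale1r addNr.
Qed.

Lemma edge_coefN q m (l : 'rV[int]_m) : eta l = 0 -> l \in edges q ->
  edge_coef q (- l) = edge_coef q l.
Proof.
move=> l0 le; have leN := edgesN le l0.
have eN : eta (- l) = 0.
  by rewrite /eta (eq_bigr _ (fun i _ => mxE _ _ _ _)) sumrN -/(eta l) l0 oppr0.
have pn : mdeg (pos_part l) = mdeg (neg_part l).
  by have := eta_parts l; rewrite l0; lia.
have B (k : 'rV[int]_m) : (k \in edges q) -> eta k = 0 -> edge_coef q k = black_coef q k.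
  move=> ke k0; rewrite /edge_coef.
  by rewrite -[k \in black_edges q]/((k \in edges q) && (eta k == 0)) ke k0.
rewrite (B _ leN eN) (B _ le l0) /black_coef /neg_part opprK addmC; congr (_ *: (_ * in_sqrt _)).
apply: eq_big => [a|a _]; last by rewrite mulnC.
by rewrite !mdegD pn.
Qed.

Section TwoVertices.
Variables (q m : nat) (l : 'rV[int]_m) (u v : zsd m).
Hypothesis (juv : joined q l u v).
Let M := graph_mx q [tuple u; v].

Lemma graph_mx_diag : M 0 0 = in_sqrt (diag_poly q u) /\ M 1 1 = in_sqrt (diag_poly q v).
Proof. by rewrite !mxE. Qed.

Lemma graph_mx_offdiag :
  M 0 1 * M 1 0 = in_sqrt ((-1) ^+ (eta l == - 2) * coef_sq q l).
Proof.
have [muv mvu] := mark_joined juv; have jvu := joined_sym juv.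
rewrite !mxE /= /tnth /= muv juv jvu mvu.
have [le /eqP ve] := andP juv.
have ->: v.2 = (eta l == - 2) (+) u.2 by rewrite ve.
rewrite mulrACA -signr_addb in_sqrtM -addbA addbb addbF; congr (_ * _).
  by rewrite [RHS]rmorph_sign.
rewrite -(edge_coef_sq le) expr2.
suff -> : edge_coef q (if eta l == - 2 then l else - l) = edge_coef q l by [].
have [l2|ln2] := eqVneq (eta l) (- 2); first by [].
have l0 : eta l = 0 by have [//|l2] := edges_eta le; rewrite l2 eqxx in ln2.
exact: edge_coefN l0 le.
Qed.

(** The difference depends on the edge only, and not on its origin. *)
Lemma diag_poly_sub : (diag_poly q u - diag_poly q v) ^+ 2 =
  edge_diff (eta l == - 2) q l ^+ 2.
Proof.
have [le /eqP ve] := andP juv.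
have linD (a b : 'rV[int]_m) : lin_poly q (a + b) = lin_poly q a + lin_poly q b.
  apply/mpolyP => k; rewrite mcoeffD !mcoeff_lin_poly; case: eqP; rewrite ?addr0 // => _.
  by rewrite -big_split; apply: eq_bigr => j _; rewrite mxE rmorphD mulrDl.
have linN (a : 'rV[int]_m) : lin_poly q (- a) = - lin_poly q a.
  apply/mpolyP => k; rewrite mcoeffN !mcoeff_lin_poly; case: eqP; rewrite ?oppr0 // => _.
  by rewrite -sumrN; apply: eq_bigr => j _; rewrite mxE rmorphN mulNr.
rewrite /diag_poly /edge_diff ve /=; case: (_ == _); case: (u.2);
  rewrite /= ?expr0 ?expr1 ?scaleN1r ?scale1r linD ?linN; ring.
Qed.

End TwoVertices.

(** The right-hand side is the discriminant of the characteristic polynomial. *)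
Lemma disc_nonsquare q m (l : 'rV[int]_m) (E : {mpoly rat[m]}) :
  (0 < q)%N -> (2 * q <= m)%N -> l \in edges q ->
  E ^+ 2 != edge_diff (eta l == - 2) q l ^+ 2 + 4%:R * ((-1) ^+ (eta l == - 2) * coef_sq q l).
Proof.
move=> q0 qm le; rewrite addrC -subr_eq.
have four (n : nat) (p : {mpoly rat[m]}) : (4 * n)%:R *: p = 4%:R * (n%:R *: p).
  by rewrite natrM -scalerA scaler_nat mulr_natl.
have [l0|l2] := edges_eta le.
  have := black_disc_nonsquare E q0 qm le l0.
  by rewrite four /coef_sq l0 eqxx /= expr0 mul1r.
have := red_disc_nonsquare E q0 qm le l2.
by rewrite scaleNr four /coef_sq l2 eqxx /= expr1 mulN1r mulrN.
Qed.

Theorem theorem2p2 (q m : nat) (hq : (1 <= q)%N) (hm : (2 * q <= m)%N)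
    (u v : zsd m) (l : 'rV[int]_m) (huv : joined q l u v) :
  exists2 chi : {poly {mpoly int[m]}},
    embed chi = char_poly (graph_mx q [tuple u; v]) & irreducible_elt chi.
Proof.
have le : l \in edges q by case/andP: huv.
have [du duE] := integral_diag q u; have [dv dvE] := integral_diag q v.
have [cs csE] := integral_coef_sq q l.
pose s : {mpoly int[m]} := (-1) ^+ (eta l == - 2) * cs.
exists ('X^2 - (du + dv) *: 'X + (du * dv - s)%:P).
  pose f : {rmorphism {mpoly int[m]} -> {mpoly rat[m]}} :=
    comp_mpoly [tuple 'X_i ^+ 2 | i < m] \o map_mpoly intr.
  have fdu : f du = in_sqrt (diag_poly q u) by rewrite -duE.
  have fdv : f dv = in_sqrt (diag_poly q v) by rewrite -dvE.
  have fs : f s = in_sqrt ((-1) ^+ (eta l == - 2) * coef_sq q l).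
    by rewrite -csE -[(-1) ^+ _](rmorph_sign (map_mpoly intr)) -rmorphM.
  rewrite -[embed _]/(map_poly f _) char_poly_mx2.
  have [-> ->] := graph_mx_diag q u v; rewrite (graph_mx_offdiag huv) -fdu -fdv -fs.
  by rewrite map_poly_quadratic rmorphD rmorphB rmorphM.
apply: monic_quadratic_irreducible => E; apply/eqP => eE.
have /eqP[] := disc_nonsquare (map_mpoly intr E) hq hm le.
rewrite -(diag_poly_sub huv) -rmorphXn eE rmorph_disc -duE -dvE -csE; congr (_ + _ * _).
by rewrite rmorphM rmorph_sign.
Qed.
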